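(* Assume the standing setup (S), smoothness (A1), bounded variance (A2) and partial gradient diversity (A3) with parameters $\delta\ge0,\rho\ge0$, and $\chi>0$. Run FedAlt for $T\ge1$ rounds with $\gamma_u=\eta/(L_u\tau_u)$ and $\gamma_v=\eta/(L_v\tau_v)$, where $$\eta\le\min\Big\{\frac{1}{24(1+\rho^2)},\ \frac{m}{128\chi^2(n-m)},\ \sqrt{\frac{m}{\chi^2 n}}\Big\}.$$ Then there is an absolute constant $C>0$ such that $$\frac1T\sum_{t=0}^{T-1}\Big(\frac{1}{L_u}\mathbb E\big[\Delta_u^{(t)}\big]+\frac{m}{nL_v}\mathbb E\big[\Delta_v^{(t)}\big]\Big)\le C\Big(\frac{\Delta F_0}{\eta T}+\eta\,\sigma_{\mathrm{alt},1}^2+\eta^2\,\sigma_{\mathrm{alt},2}^2\Big),$$ where $\sigma_{\mathrm{alt},1}^2=\frac{\delta^2}{L_u}(1-\frac mn)+\frac{\sigma_u^2}{L_u}+\frac{\sigma_v^2(m+\chi^2(n-m))}{L_v n}$ and $\sigma_{\mathrm{alt},2}^2=\frac{\sigma_u^2+\delta^2}{L_u}(1-\tau_u^{-1})+\frac{\sigma_v^2 m}{L_v n}(1-\tau_v^{-1})+\frac{\chi^2\sigma_v^2}{L_v}$.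
   Context: (S) Setup. There are $n\ge2$ devices. Device $i$ has a data distribution $\mathcal D_i$ on a space $\mathcal Z$ and a continuously differentiable loss $F_i:\mathbb R^{d_0}\times\mathbb R^{d_i}\to\mathbb R$, $(u,v_i)\mapsto F_i(u,v_i)$; $u$ are shared parameters, $v_i$ personal parameters. Write $V=(v_1,\dots,v_n)$ and $F(u,V)=\frac1n\sum_{i=1}^nF_i(u,v_i)$, assumed bounded below by $F^\star$. There are stochastic gradient maps $G_{i,u}(u,v_i,z)$, $G_{i,v}(u,v_i,z)$. Fix integers $1\le m\le n$, $T\ge1$. FedAlt (with local step counts $\tau_u,\tau_v\ge1$ and step sizes $\gamma_u,\gamma_v>0$): start from $(u^{(0)},V^{(0)})$. In round $t=0,\dots,T-1$, a set $S^{(t)}$ of $m$ devices is sampled uniformly at random without replacement from $\{1,\dots,n\}$ (independently across rounds). Each $i\in S^{(t)}$ sets $v_{i,0}=v_i^{(t)}$, runs $v_{i,k+1}=v_{i,k}-\gamma_vG_{i,v}(u^{(t)},v_{i,k},z)$ for $k=0,\dots,\tau_v-1$ and sets $v_i^{(t+1)}=v_{i,\tau_v}$; then sets $u_{i,0}=u^{(t)}$, runs $u_{i,k+1}=u_{i,k}-\gamma_uG_{i,u}(u_{i,k},v_i^{(t+1)},z)$ for $k=0,\dots,\tau_u-1$; each gradient call uses a fresh sample $z\sim\mathcal D_i$ independent of everything else. Devices $i\notin S^{(t)}$ keep $v_i^{(t+1)}=v_i^{(t)}$. The server sets $u^{(t+1)}=\frac1m\sum_{i\in S^{(t)}}u_{i,\tau_u}$.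 (A1) Smoothness: for every $i$, $u\mapsto\nabla_uF_i(u,v_i)$ is $L_u$-Lipschitz, $v_i\mapsto\nabla_vF_i(u,v_i)$ is $L_v$-Lipschitz, $v_i\mapsto\nabla_uF_i(u,v_i)$ is $L_{uv}$-Lipschitz, $u\mapsto\nabla_vF_i(u,v_i)$ is $L_{vu}$-Lipschitz, and $\max\{L_{uv},L_{vu}\}\le\chi\sqrt{L_uL_v}$. (A2) Bounded variance: for all $i,u,v_i$, $\mathbb E_{z\sim\mathcal D_i}G_{i,u}(u,v_i,z)=\nabla_uF_i(u,v_i)$, $\mathbb E_{z\sim\mathcal D_i}G_{i,v}(u,v_i,z)=\nabla_vF_i(u,v_i)$, $\mathbb E\|G_{i,u}(u,v_i,z)-\nabla_uF_i(u,v_i)\|^2\le\sigma_u^2$, $\mathbb E\|G_{i,v}(u,v_i,z)-\nabla_vF_i(u,v_i)\|^2\le\sigma_v^2$. (A3) Partial gradient diversity: for all $u,V$, $\frac1n\sum_{i=1}^n\|\nabla_uF_i(u,v_i)-\nabla_uF(u,V)\|^2\le\delta^2+\rho^2\|\nabla_uF(u,V)\|^2$. Notation: $\Delta F_0=F(u^{(0)},V^{(0)})-F^\star$, $\Delta_u^{(t)}=\|\nabla_uF(u^{(t)},V^{(t)})\|^2$, $\Delta_v^{(t)}=\frac1n\sum_{i=1}^n\|\nabla_vF_i(u^{(t)},v_i^{(t)})\|^2$; expectations are over all randomness. *)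

(* Defs.v *)
From HB Require Import structures.
From mathcomp Require Import all_boot all_order all_algebra.
From mathcomp Require Import all_classical all_reals all_analysis.
Set Implicit Arguments. Unset Strict Implicit. Unset Printing Implicit Defensive.
Import Order.TTheory GRing.Theory Num.Theory.
Import numFieldNormedType.Exports.
Local Open Scope classical_set_scope.
Local Open Scope ring_scope.

(* Squared Euclidean norm and Euclidean norm on R^k = 'rV[R]_k.
   (MathComp's `norm on matrices is the max-norm, so we define the
   Euclidean one explicitly.) *)
Definition sqnorm (R : realType) (k : nat) (x : 'rV[R]_k) : R :=
  \sum_(j < k) x 0 j ^+ 2.
Definition enorm (R : realType) (k : nat) (x : 'rV[R]_k) : R :=
  Num.sqrt (sqnorm x).

Definition grad (R : realType) (k : nat) (f : 'rV[R]_k -> R) (x : 'rV[R]_k)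
  : 'rV[R]_k := \row_(j < k) derive f x (delta_mx 0 j).

Definition gradu (R : realType) (d0 dv : nat)
  (f : 'rV[R]_d0 -> 'rV[R]_dv -> R) (u : 'rV[R]_d0) (v : 'rV[R]_dv) : 'rV[R]_d0 :=
  grad (fun u' => f u' v) u.
Definition gradv (R : realType) (d0 dv : nat)
  (f : 'rV[R]_d0 -> 'rV[R]_dv -> R) (u : 'rV[R]_d0) (v : 'rV[R]_dv) : 'rV[R]_dv :=
  grad (fun v' => f u v') v.

Definition Favg (R : realType) (n d0 : nat) (d : 'I_n -> nat)
  (F : forall i : 'I_n, 'rV[R]_d0 -> 'rV[R]_(d i) -> R)
  (u : 'rV[R]_d0) (V : forall i : 'I_n, 'rV[R]_(d i)) : R :=
  n%:R^-1 * \sum_(i < n) F i u (V i).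

Definition gradFu (R : realType) (n d0 : nat) (d : 'I_n -> nat)
  (F : forall i : 'I_n, 'rV[R]_d0 -> 'rV[R]_(d i) -> R)
  (u : 'rV[R]_d0) (V : forall i : 'I_n, 'rV[R]_(d i)) : 'rV[R]_d0 :=
  grad (fun u' => Favg F u' V) u.

(* Measurability of g : R^a x R^b x Z -> R with respect to the product of the
   Borel sigma-algebras of R^a, R^b (generated by open sets) and the
   sigma-algebra of Z, i.e. the sigma-algebra generated by the rectangles
   U x V x B (U, V open, B measurable). *)
Definition jointly_measurable (R : realType) (dZ : measure_display)
  (Z : measurableType dZ) (a b : nat) (g : 'rV[R]_a * 'rV[R]_b * Z -> R) : Prop :=
  forall O : set R, open O ->
    <<s [set W | exists U V B, [/\ open U, open V, measurable B &
                    W = (U `*` V) `*` B]] >> (g @^-1` O).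

(* K steps of local SGD  x_{k+1} = x_k - gam * g x_k k  started from x0
   (g x k is the stochastic gradient at x using the k-th fresh sample). *)
Fixpoint lsgd (R : realType) (k : nat) (g : 'rV[R]_k -> nat -> 'rV[R]_k)
  (gam : R) (x0 : 'rV[R]_k) (K : nat) : 'rV[R]_k :=
  match K with
  | 0 => x0
  | K'.+1 => let x := lsgd g gam x0 K' in x - gam *: g x K'
  end.

Definition fedalt_round (R : realType) (n d0 : nat) (d : 'I_n -> nat)
  (dZ : measure_display) (Z : measurableType dZ) (m : nat)
  (Gu : forall i : 'I_n, 'rV[R]_d0 -> 'rV[R]_(d i) -> Z -> 'rV[R]_d0)
  (Gv : forall i : 'I_n, 'rV[R]_d0 -> 'rV[R]_(d i) -> Z -> 'rV[R]_(d i))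
  (gam_u gam_v : R) (tau_u tau_v : nat)
  (S : {set 'I_n}) (zv zu : 'I_n -> nat -> Z)
  (st : 'rV[R]_d0 * (forall i : 'I_n, 'rV[R]_(d i)))
  : 'rV[R]_d0 * (forall i : 'I_n, 'rV[R]_(d i)) :=
  let u := st.1 in
  let V := st.2 in
  let V' := fun i : 'I_n =>
    if i \in S then lsgd (fun x k => Gv i u x (zv i k)) gam_v (V i) tau_v
    else V i in
  (m%:R^-1 *: \sum_(i in S) lsgd (fun x k => Gu i x (V' i) (zu i k)) gam_u u tau_u,
   V').

Fixpoint fedalt_state (R : realType) (n d0 : nat) (d : 'I_n -> nat)
  (dZ : measure_display) (Z : measurableType dZ) (m : nat)
  (Gu : forall i : 'I_n, 'rV[R]_d0 -> 'rV[R]_(d i) -> Z -> 'rV[R]_d0)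
  (Gv : forall i : 'I_n, 'rV[R]_d0 -> 'rV[R]_(d i) -> Z -> 'rV[R]_(d i))
  (gam_u gam_v : R) (tau_u tau_v : nat)
  (S : nat -> {set 'I_n}) (zv zu : nat -> 'I_n -> nat -> Z)
  (u0 : 'rV[R]_d0) (V0 : forall i : 'I_n, 'rV[R]_(d i)) (t : nat)
  : 'rV[R]_d0 * (forall i : 'I_n, 'rV[R]_(d i)) :=
  match t with
  | 0 => (u0, V0)
  | t'.+1 => fedalt_round m Gu Gv gam_u gam_v tau_u tau_v (S t') (zv t') (zu t')
               (fedalt_state m Gu Gv gam_u gam_v tau_u tau_v S zv zu u0 V0 t')
  end.

Definition mutually_independent (R : realType) (d : measure_display)
  (Omega : measurableType d) (P : probability Omega R) (I : eqType)
  (E : I -> set (set Omega)) : Prop :=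
  forall (J : seq I), uniq J ->
  forall A : I -> set Omega, (forall j, j \in J -> E j (A j)) ->
    P (\big[setI/setT]_(j <- J) A j) = (\prod_(j <- J) fine (P (A j)))%:E.

(* Index of the random ingredients of FedAlt: the sampled set of round t,
   the k-th v-phase sample of device i in round t, the k-th u-phase sample of
   device i in round t. *)
Definition fedalt_index (n : nat) : eqType :=
  (nat + ((nat * 'I_n * nat) + (nat * 'I_n * nat)))%type.

Definition fedalt_events (d : measure_display)
  (Omega : measurableType d) (n : nat) (dZ : measure_display)
  (Z : measurableType dZ) (S : nat -> Omega -> {set 'I_n})
  (zv zu : nat -> 'I_n -> nat -> Omega -> Z) (j : fedalt_index n)
  : set (set Omega) :=
  match j with
  | inl t => [set A | exists B : set {set 'I_n}, A = S t @^-1` B]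
  | inr (inl (t, i, k)) =>
      [set A | exists B : set Z, measurable B /\ A = zv t i k @^-1` B]
  | inr (inr (t, i, k)) =>
      [set A | exists B : set Z, measurable B /\ A = zu t i k @^-1` B]
  end.

(* Main.v *)
(**
The u-phase of a round uses v_i^(t+1), which depends on the sampled set S.  To
decouple the two, every device is run virtually: vt_i is the outcome of the
v-phase of device i whether or not it is sampled, and gb is the gradient of F
in u at (u, vt).  Both are independent of S.

Pathwise, the decrease F(u', V') - F(u, V) is at most a sum over i of a term
[round_in i] if i is in S and [round_out i] otherwise, none of which depends on
S: the gradient at (u, V') is compared with gb, the difference being a sum over
the unsampled devices.  Taking expectations over S then only needs
P(i in S) = m/n; in particular the factor 1 - m/n in front of delta^2 comes
from bounding the deviation of a sample mean through the complement of S.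

The averaged right-hand side is again bounded pathwise, by -eta times the
squared gradients plus squared local noises and inner products of the noise
with gv_i or gb.  Local drift is controlled pathwise by the first gradient and
the noises of that run.  Each sample is independent of the sigma-algebra
generated by all the other random ingredients, so by Fubini the inner products
have mean zero and the squared noises have mean at most sigma^2.  Summing over
the rounds telescopes, with C = 480.
*)
Require Import Defs.
From HB Require Import structures.
From mathcomp Require Import all_boot all_order all_algebra.
From mathcomp Require Import all_classical all_reals all_analysis.
From mathcomp Require Import measurable_realfun ring lra.
Import Order.TTheory GRing.Theory Num.Theory.
Import numFieldNormedType.Exports.
Set Implicit Arguments. Unset Strict Implicit. Unset Printing Implicit Defensive.
Local Open Scope classical_set_scope.
Local Open Scope ring_scope.

(** * Euclidean vectors and local SGD *)

Section Euclidean.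
Context {R : realType}.

(** The u-phase of device i starts from the gradient of [F i] at (u, vt_i), and [gb] is the mean of
    these over all devices, so averaged inner products give exactly the squared norm of [gb]. Two
    gaps remain: the theorem measures the gradient at (u, V), and unsampled devices keep their old
    v_i. The two step-size conditions on chi close them: chi^2 eta^2 <= m/n the first, 128 chi^2 (1
    - m/n) eta <= m/n the second. The condition on rho absorbs the rho^2 part of the diversity. To
    keep the factor 1 - m/n on the term of order eta in delta^2, a local u-run is compared with one
    exact gradient step of length eta / Lu. The residual sees the gradient only at higher order,
    with a factor 1 - 1/tau_u; the sampling error sits in the mean of the exact steps. Integrability
    has to be earned, as F is only bounded below: Tonelli makes the noise square-integrable,
    induction then gives the iterates, and F along them is trapped between integrable quadratic
    bounds. The constant is 80 * 6: up to noise, a round decreases F by eta / 80 times the measured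
    quantity, and 6 bounds the noise coefficients. *)

Definition dot {k : nat} (x y : 'rV[R]_k) : R := \sum_(j < k) x 0 j * y 0 j.

Lemma sqnormE k (x : 'rV[R]_k) : sqnorm x = dot x x.
Proof. by apply: eq_bigr => j _; rewrite expr2. Qed.

Lemma sqnorm_ge0 k (x : 'rV[R]_k) : 0 <= sqnorm x.
Proof. by apply: sumr_ge0 => j _; rewrite sqr_ge0. Qed.

Lemma dotDr k (x y z : 'rV[R]_k) : dot x (y + z) = dot x y + dot x z.
Proof. by rewrite -big_split; apply: eq_bigr => j _; rewrite mxE mulrDr. Qed.

Lemma dotZr k a (x y : 'rV[R]_k) : dot x (a *: y) = a * dot x y.
Proof. by rewrite mulr_sumr; apply: eq_bigr => j _; rewrite mxE mulrCA. Qed.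

Lemma dotNr k (x y : 'rV[R]_k) : dot x (- y) = - dot x y.
Proof. by rewrite -scaleN1r dotZr mulN1r. Qed.

Lemma dotC k (x y : 'rV[R]_k) : dot x y = dot y x.
Proof. by apply: eq_bigr => j _; rewrite mulrC. Qed.

Lemma dotDl k (x y z : 'rV[R]_k) : dot (x + y) z = dot x z + dot y z.
Proof. by rewrite dotC dotDr !(dotC z). Qed.

Lemma dot0r k (x : 'rV[R]_k) : dot x 0 = 0.
Proof. by rewrite -(scale0r 0) dotZr mul0r. Qed.

Lemma dot_sumr k (I : Type) (r : seq I) (P : pred I) (x : 'rV[R]_k)
    (f : I -> 'rV[R]_k) :
  dot x (\sum_(i <- r | P i) f i) = \sum_(i <- r | P i) dot x (f i).
Proof. by elim/big_rec2: _ => [|i y1 y2 _ <-]; rewrite ?dot0r ?dotDr. Qed.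

Lemma sqnormZ k a (x : 'rV[R]_k) : sqnorm (a *: x) = a ^+ 2 * sqnorm x.
Proof. by rewrite !sqnormE dotZr dotC dotZr mulrA expr2. Qed.

Lemma sqnormN k (x : 'rV[R]_k) : sqnorm (- x) = sqnorm x.
Proof. by rewrite -scaleN1r sqnormZ sqrrN expr1n mul1r. Qed.

Lemma sqnormD k (x y : 'rV[R]_k) :
  sqnorm (x + y) = sqnorm x + 2 * dot x y + sqnorm y.
Proof. by rewrite !sqnormE dotDr !dotDl (dotC y x); ring. Qed.

Lemma dot_young k (a : R) (x y : 'rV[R]_k) : 0 < a ->
  2 * dot x y <= a * sqnorm x + a^-1 * sqnorm y.
Proof.
move=> a0; have := sqnorm_ge0 (a *: x - y).
rewrite sqnormD sqnormN dotNr sqnormZ dotC dotZr dotC => h.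
rewrite -(ler_pM2l a0) mulrDr !mulrA divff ?gt_eqF// mul1r; nra.
Qed.

Lemma dot_le_half k (x y : 'rV[R]_k) :
  dot x y <= sqnorm x / 2 + sqnorm y / 2.
Proof. by have := dot_young x y ltr01; rewrite invr1; lra. Qed.

Lemma sqnormD_le k (x y : 'rV[R]_k) :
  sqnorm (x + y) <= 2 * (sqnorm x + sqnorm y).
Proof. by rewrite sqnormD; have := dot_le_half x y; lra. Qed.

Lemma sqnormD3_le k (x y z : 'rV[R]_k) :
  sqnorm (x + y + z) <= 3 * (sqnorm x + sqnorm y + sqnorm z).
Proof.
rewrite !sqnormD dotDl.
have := dot_le_half x y; have := dot_le_half x z.
by have := dot_le_half y z; lra.
Qed.

(** Lagrange's identity: the sum of (a_i - a_j)^2 over all pairs is twice the gap between the two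
    sides. *)
Lemma sqr_sum_le (I : finType) (A : {pred I}) (a : I -> R) :
  (\sum_(i in A) a i) ^+ 2 <= #|A|%:R * \sum_(i in A) a i ^+ 2.
Proof.
have : 0 <= \sum_(i in A) \sum_(j in A) (a i - a j) ^+ 2.
  by apply: sumr_ge0 => i _; apply: sumr_ge0 => j _; rewrite sqr_ge0.
have -> : \sum_(i in A) \sum_(j in A) (a i - a j) ^+ 2 =
    2 * (#|A|%:R * \sum_(i in A) a i ^+ 2) - 2 * (\sum_(i in A) a i) ^+ 2.
  transitivity (\sum_(i in A) (#|A|%:R * a i ^+ 2 + \sum_(j in A) a j ^+ 2
      - 2 * a i * (\sum_(j in A) a j))).
    apply: eq_bigr => i _; rewrite mulr_sumr -sumrN mulrC mulr_natr -sumr_const.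
    by rewrite -!big_split; apply: eq_bigr => j _ /=; ring.
  rewrite 2!big_split /= sumr_const -mulr_sumr sumrN -mulr_suml -mulr_sumr.
  by rewrite -mulr_natl; ring.
by lra.
Qed.

Lemma sqnorm_sum_le k (I : finType) (A : {pred I}) (f : I -> 'rV[R]_k) :
  sqnorm (\sum_(i in A) f i) <= #|A|%:R * \sum_(i in A) sqnorm (f i).
Proof.
rewrite /sqnorm exchange_big mulr_sumr; apply: ler_sum => j _ /=.
by rewrite summxE; exact: sqr_sum_le.
Qed.

Lemma sqnorm_ord_sum_le k n (f : 'I_n -> 'rV[R]_k) :
  sqnorm (\sum_(i < n) f i) <= n%:R * \sum_(i < n) sqnorm (f i).
Proof. by have := sqnorm_sum_le predT f; rewrite card_ord. Qed.

Lemma enorm_sqr k (x : 'rV[R]_k) : enorm x ^+ 2 = sqnorm x.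
Proof. by rewrite sqr_sqrtr ?sqnorm_ge0. Qed.

Lemma enorm_ge0 k (x : 'rV[R]_k) : 0 <= enorm x.
Proof. exact: sqrtr_ge0. Qed.

(** Two constants are kept apart because [Luv] and [Lvu] come without a sign and are only known to
    be at most chi * sqrt(Lu * Lv), which plays the role of [M]. *)
Lemma enorm_le_sqnorm k l (x : 'rV[R]_k) (y : 'rV[R]_l) (L M : R) :
  L <= M -> 0 <= M -> enorm x <= L * enorm y -> sqnorm x <= M ^+ 2 * sqnorm y.
Proof.
move=> LM M0 h; rewrite -!enorm_sqr -exprMn.
rewrite lerXn2r ?nnegrE ?enorm_ge0 ?mulr_ge0 ?enorm_ge0//.
by apply: le_trans h _; rewrite ler_wpM2r ?enorm_ge0.
Qed.

Lemma sqnorm_le_enorm k l (x : 'rV[R]_k) (y : 'rV[R]_l) (M : R) :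
  0 <= M -> sqnorm x <= M ^+ 2 * sqnorm y -> enorm x <= M * enorm y.
Proof.
move=> M0; rewrite -!enorm_sqr -exprMn => h.
by rewrite -(@ler_pXn2r _ 2)// ?nnegrE ?mulr_ge0 ?enorm_ge0.
Qed.

Lemma dot_le_enorm k (x y : 'rV[R]_k) : dot x y <= enorm x * enorm y.
Proof.
have [x0|x0] := eqVneq (enorm x) 0.
  rewrite x0 mul0r; have : sqnorm x = 0 by rewrite -enorm_sqr x0 expr0n.
  move/eqP; rewrite psumr_eq0 => [/allP h|j _]; last by rewrite sqr_ge0.
  rewrite /dot big1// => j _; have := h j (mem_index_enum _).
  by rewrite /= sqrf_eq0 => /eqP ->; rewrite mul0r.
have [y0|y0] := eqVneq (enorm y) 0.
  rewrite y0 mulr0; have : sqnorm y = 0 by rewrite -enorm_sqr y0 expr0n.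
  move/eqP; rewrite psumr_eq0 => [/allP h|j _]; last by rewrite sqr_ge0.
  rewrite /dot big1// => j _; have := h j (mem_index_enum _).
  by rewrite /= sqrf_eq0 => /eqP ->; rewrite mulr0.
have xp : 0 < enorm x by rewrite lt_def x0 enorm_ge0.
have yp : 0 < enorm y by rewrite lt_def y0 enorm_ge0.
(* The weight |y| / |x| makes both terms of Young's inequality equal to |x| |y|; it is why zero
   norms were treated apart. *)
have := dot_young x y (divr_gt0 yp xp).
rewrite -!enorm_sqr invf_div => h.
suff : 2 * dot x y <= 2 * (enorm x * enorm y) by lra.
apply: le_trans h _; rewrite le_eqVlt; apply/orP; left; apply/eqP.
by field; rewrite x0 y0.
Qed.

End Euclidean.

Ltac nneg := solve [repeat first
  [ done | apply: sqr_ge0 | apply: sqnorm_ge0 | apply: sumr_ge0 => ? _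
  | apply: mulr_ge0 | apply: addr_ge0 | rewrite invr_ge0 | apply: exprn_ge0
  | apply: ltW; done ]].

(** * Local SGD: one run, pathwise *)

Section LocalSGD.
Context {R : realType} {k : nat}.
Context (g : 'rV[R]_k -> 'rV[R]_k) (G : 'rV[R]_k -> nat -> 'rV[R]_k).
Context (gam L : R) (x0 : 'rV[R]_k).
Hypothesis gam0 : 0 <= gam.
Hypothesis L0 : 0 < L.
Hypothesis gL : forall x y, sqnorm (g x - g y) <= L ^+ 2 * sqnorm (x - y).

Let x := lsgd G gam x0.

Definition sgd_noise (j : nat) : 'rV[R]_k := G (x j) j - g (x j).
Let xi := sgd_noise.

(** The recursion is unrolled with each step split into initial gradient, drift and noise, because
    the three are treated differently: the first drives the descent, the second is a Lipschitz
    error, the third averages out. *)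
Lemma lsgdB K : x K - x0 = - gam *: \sum_(j < K) (g x0 + (g (x j) - g x0) + xi j).
Proof.
elim: K => [|K IH]; first by rewrite big_ord0 scaler0 /x /= subrr.
rewrite big_ord_recr /= scalerDr -IH /xi /sgd_noise.
have -> : g x0 + (g (x K) - g x0) + (G (x K) K - g (x K)) = G (x K) K.
  by rewrite (addrC (g x0)) subrK addrC subrK.
by rewrite /x /= scaleNr addrAC.
Qed.

(* Strong induction on j: the Lipschitz term contributes at most a quarter of
   the bound, since gam * L * K is small. *)
Lemma lsgd_drift K : gam * L * K%:R <= 24^-1 -> forall j, (j <= K)%N ->
  sqnorm (x j - x0) <= 4 * gam ^+ 2 * K%:R *
    (K%:R * sqnorm (g x0) + \sum_(i < K) sqnorm (xi i)).
Proof.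
move=> hK; elim/ltn_ind => j IH jK.
set N := \sum_(i < K) _; set Q := _ + N.
have N0 : 0 <= N by nneg.
have Q0 : 0 <= Q by nneg.
have jKR : j%:R <= K%:R :> R by rewrite ler_nat.
rewrite lsgdB sqnormZ sqrrN.
apply: (@le_trans _ _ (gam ^+ 2 * (K%:R * (3 * (Q + K%:R * (L ^+ 2 *
    (4 * gam ^+ 2 * K%:R * Q))))))).
  apply: ler_wpM2l; first exact: sqr_ge0.
  apply: le_trans (sqnorm_ord_sum_le _) _.
  apply: ler_pM => //.
    nneg.
  apply: (@le_trans _ _ (\sum_(i < j) 3 * (sqnorm (g x0) +
      L ^+ 2 * (4 * gam ^+ 2 * K%:R * Q) + sqnorm (xi i)))).
    apply: ler_sum => i _; apply: le_trans (sqnormD3_le _ _ _) _.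
    rewrite ler_pM2l// lerD2r lerD2l; apply: le_trans (gL _ _) _.
    rewrite ler_wpM2l ?sqr_ge0//; apply: IH => //.
    by rewrite ltnW// (leq_trans (ltn_ord i)).
  rewrite -mulr_sumr ler_pM2l// big_split /= sumr_const card_ord -[_ *+ j]mulr_natl.
  have h1 : \sum_(i < j) sqnorm (xi i) <= N.
    rewrite /N -(subnKC jK) big_split_ord /= lerDl.
    nneg.
  have h2 : 0 <= sqnorm (g x0) + L ^+ 2 * (4 * gam ^+ 2 * K%:R * Q).
    nneg.
  apply: (@le_trans _ _ (K%:R * (sqnorm (g x0) + L ^+ 2 * (4 * gam ^+ 2 * K%:R * Q)) + N)).
    by apply: lerD => //; apply: ler_wpM2r.
  by rewrite /Q; lra.
have p0 : 0 <= gam * L * K%:R by nneg.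
have psq : (gam * L * K%:R) ^+ 2 <= 12^-1.
  by rewrite expr2; nra.
have w0 : 0 <= gam ^+ 2 * K%:R * Q by nneg.
have -> : gam ^+ 2 * (K%:R * (3 * (Q + K%:R * (L ^+ 2 * (4 * gam ^+ 2 * K%:R * Q)))))
  = 3 * (gam ^+ 2 * K%:R * Q) * (1 + 4 * (gam * L * K%:R) ^+ 2) by ring.
have -> : 4 * gam ^+ 2 * K%:R * Q = 4 * (gam ^+ 2 * K%:R * Q) by ring.
by nra.
Qed.

Context (tau : nat) (eta : R).
Hypothesis tau_gt0 : (0 < tau)%N.
Hypothesis eta_gt0 : 0 < eta.
Hypothesis eta_le : eta <= 24^-1.
Hypothesis gamE : gam = eta / (L * tau%:R).

Let nu : R := (\sum_(i < tau) sqnorm (xi i)) / tau%:R.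
Let kap : R := 1 - tau%:R^-1.

Let tauR : 0 < tau%:R :> R. Proof. by rewrite ltr0n. Qed.
Let Lneq : L != 0. Proof. by rewrite gt_eqF. Qed.
Let tneq : tau%:R != 0 :> R. Proof. by rewrite gt_eqF. Qed.
Let nu0 : 0 <= nu. Proof. by rewrite divr_ge0 ?ler0n//; nneg. Qed.

Lemma lsgd_dist : sqnorm (x tau - x0) <=
  4 * (eta ^+ 2 / L ^+ 2) * (sqnorm (g x0) + nu).
Proof.
have /lsgd_drift h : gam * L * tau%:R <= 24^-1.
  by rewrite gamE (_ : _ * _ = eta)//; field; rewrite Lneq tneq.
apply: le_trans (h _ (leqnn _)) _.
rewrite le_eqVlt; apply/orP; left; apply/eqP; rewrite gamE /nu.
by field; rewrite Lneq tneq.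
Qed.

(** An iterate x_j with j < tau has made at most tau - 1 steps, so the drift bound is used with K =
    tau - 1. This is the origin of the factor [kap] = 1 - 1/tau, which vanishes for a single local
    step. *)
Lemma lsgd_sum_drift : \sum_(j < tau) sqnorm (x j - x0) <=
  tau%:R * (4 * (eta ^+ 2 / L ^+ 2) * kap * (sqnorm (g x0) + nu)).
Proof.
rewrite mulr_natl -[X in _ *+ X](card_ord tau) -sumr_const.
apply: ler_sum => j _.
have tE : tau.-1%:R = tau%:R - 1 :> R by rewrite -subn1 natrB.
have t1 : 1 <= tau%:R :> R by rewrite ler1n.
have /lsgd_drift h : gam * L * tau.-1%:R <= 24^-1.
  apply: le_trans eta_le; rewrite gamE tE.
  have -> : eta / (L * tau%:R) * L * (tau%:R - 1) = eta - eta / tau%:R.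
    by field; rewrite Lneq tneq.
  by rewrite gerBl divr_ge0 // ltW.
have jt : (j <= tau.-1)%N by rewrite -ltnS prednK.
apply: le_trans (h _ jt) _.
have hN : \sum_(i < tau.-1) sqnorm (xi i) <= tau%:R * nu.
  rewrite /nu mulrCA divff// mulr1.
  rewrite -[in leRHS](prednK tau_gt0) big_ord_recr /= lerDl.
  exact: sqnorm_ge0.
have kap0 : 0 <= kap by rewrite /kap subr_ge0 invf_le1.
have kap1 : kap <= 1 by rewrite /kap gerBl invr_ge0.
have tk : tau.-1%:R = tau%:R * kap.
  by rewrite tE /kap mulrBr mulr1 divff.
rewrite tk in hN *.
apply: (@le_trans _ _ (4 * gam ^+ 2 * (tau%:R * kap) *
    (tau%:R * kap * sqnorm (g x0) + tau%:R * nu))).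
  by rewrite ler_wpM2l ?lerD2l//; nneg.
have -> : 4 * gam ^+ 2 * (tau%:R * kap) * (tau%:R * kap * sqnorm (g x0) + tau%:R * nu)
    = 4 * (eta ^+ 2 / L ^+ 2) * kap * (kap * sqnorm (g x0) + nu).
  by rewrite gamE; field; rewrite Lneq tneq.
apply: ler_wpM2l; first by nneg.
by rewrite lerD2r ler_piMl ?sqnorm_ge0.
Qed.

(** The noise stays linear, so that it can vanish in expectation; only the drift goes through
    Young's inequality, at the cost of half of |W|^2. [W] is free: it will be the initial gradient
    in the v-phase, and [gb], common to all devices, in the u-phase. *)
Lemma lsgd_inner (W : 'rV[R]_k) : dot W (x tau - x0) <=
  eta / L * (- dot W (g x0) + sqnorm W / 2 +
             2 * eta ^+ 2 * kap * (sqnorm (g x0) + nu))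
  - gam * \sum_(j < tau) dot W (xi j).
Proof.
rewrite lsgdB dotZr dot_sumr.
have h (j : 'I_tau) : - dot W (g x0 + (g (x j) - g x0) + xi j) <=
    - dot W (g x0) + sqnorm W / 2 + L ^+ 2 / 2 * sqnorm (x j - x0) - dot W (xi j).
  rewrite !dotDr; have := dot_le_half (- W) (g (x j) - g x0).
  by rewrite sqnormN dotC dotNr dotC dotDr; have := gL (x j) x0; lra.
rewrite mulNr -mulrN -sumrN.
apply: (@le_trans _ _ (gam * \sum_(j < tau) (- dot W (g x0) + sqnorm W / 2 +
    L ^+ 2 / 2 * sqnorm (x j - x0) - dot W (xi j)))).
  by rewrite ler_wpM2l//; apply: ler_sum.
rewrite 2!big_split /= sumr_const card_ord sumrN -mulr_sumr.
rewrite mulrDr mulrN lerD2r.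
apply: (@le_trans _ _ (gam * ((- dot W (g x0) + sqnorm W / 2) *+ tau + L ^+ 2 / 2 *
   (tau%:R * (4 * (eta ^+ 2 / L ^+ 2) * kap * (sqnorm (g x0) + nu)))))).
  rewrite ler_wpM2l// lerD2l ler_wpM2l ?lsgd_sum_drift//; nneg.
rewrite le_eqVlt; apply/orP; left; apply/eqP; rewrite gamE -[_ *+ tau]mulr_natl.
by field; rewrite Lneq tneq.
Qed.

(** Distance to one exact gradient step of length eta / L. The initial gradient cancels at first
    order and survives only through the drift, with the extra factor eta^2 * kap; [lsgd_dist] alone
    would lose this gain. *)
Lemma lsgd_residual : sqnorm (x tau - x0 + (eta / L) *: g x0) <=
  eta ^+ 2 / L ^+ 2 * (8 * eta ^+ 2 * kap * (sqnorm (g x0) + nu) + 2 * nu).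
Proof.
have -> : x tau - x0 + (eta / L) *: g x0 =
    - gam *: \sum_(j < tau) (g (x j) - g x0 + xi j).
  rewrite lsgdB.
  under eq_bigr do rewrite -addrA.
  rewrite big_split /= sumr_const card_ord scalerDr addrAC -[RHS]add0r.
  congr (_ + _); rewrite -scaler_nat scalerA (_ : - gam * tau%:R = - (eta / L)).
    by rewrite scaleNr addNr.
  by rewrite gamE; field; rewrite Lneq tneq.
rewrite sqnormZ sqrrN.
apply: (@le_trans _ _ (gam ^+ 2 * (tau%:R * (2 * (L ^+ 2 * (tau%:R *
   (4 * (eta ^+ 2 / L ^+ 2) * kap * (sqnorm (g x0) + nu))) + tau%:R * nu))))).
  rewrite ler_wpM2l ?sqr_ge0//; apply: le_trans (sqnorm_ord_sum_le _) _.
  rewrite ler_wpM2l//.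
  apply: (@le_trans _ _ (\sum_(j < tau) 2 * (L ^+ 2 * sqnorm (x j - x0) + sqnorm (xi j)))).
    apply: ler_sum => j _; apply: le_trans (sqnormD_le _ _) _.
    by rewrite ler_pM2l// lerD2r.
  rewrite -mulr_sumr ler_pM2l// big_split /= -mulr_sumr.
  rewrite lerD ?ler_wpM2l ?sqr_ge0 ?lsgd_sum_drift//.
  by rewrite /nu mulrCA divff// mulr1.
rewrite le_eqVlt; apply/orP; left; apply/eqP; rewrite gamE.
by field; rewrite Lneq tneq.
Qed.

End LocalSGD.

(** * Smooth functions *)

Section Descent.
Context {R : realType}.

Lemma dot_grad k (f : 'rV[R]_k -> R) (a h : 'rV[R]_k) :
  differentiable f a -> dot (grad f a) h = 'D_h f a.
Proof.
move=> df; rewrite deriveE// [in RHS](row_sum_delta h) linear_sum.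
apply: eq_bigr => j _; rewrite linearZ /= mxE deriveE// mulrC.
by [].
Qed.

Lemma is_derive_line k (f : 'rV[R]_k -> R) (a h : 'rV[R]_k) (s : R) :
  differentiable f (a + s *: h) ->
  is_derive s 1 (fun r : R => f (a + r *: h)) (dot (grad f (a + s *: h)) h).
Proof.
move=> df; rewrite dot_grad//.
have E : (fun t : R => t^-1 *: ((fun r : R => f (a + r *: h)) (t *: 1 + s)
    - f (a + s *: h))) =
  (fun t : R => t^-1 *: (f (t *: h + (a + s *: h)) - f (a + s *: h))).
  apply/funext => t; congr (_ *: (f _ - _)).
  by rewrite scalerDl addrCA -scalerA scale1r.
have D : derivable f (a + s *: h) h by exact: diff_derivable.
split; first by move: D; rewrite /derivable E.
by rewrite /derive E.
Qed.

Lemma descent k (f : 'rV[R]_k -> R) (L : R) (x y : 'rV[R]_k) : 0 <= L ->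
  (forall z, differentiable f z) ->
  (forall z z', enorm (grad f z - grad f z') <= L * enorm (z - z')) ->
  f y <= f x + dot (grad f x) (y - x) + L / 2 * sqnorm (y - x).
Proof.
move=> L0 df gL; set h := y - x.
pose c := dot (grad f x) h.
(* Subtracting the quadratic model makes the derivative nonpositive for s in ]0, 1[, so the mean
   value theorem replaces the integration of the gradient along the segment. *)
pose phi (s : R) := f (x + s *: h) - s * c - L / 2 * sqnorm h * s ^+ 2.
pose dphi (s : R) := dot (grad f (x + s *: h)) h - c - L * s * sqnorm h.
have dE (s : R) : is_derive s 1 phi (dphi s).
  have := is_derive_line (df (x + s *: h)) => d1.
  rewrite /phi /dphi; apply: is_derive_eq.
  have scE (p q : R) : p *: (q : R^o) = p * q by [].
  rewrite !scE. by field.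
have [s /andP [s0 s1] E] : exists2 s, s \in `]0, 1[%R & phi 1 - phi 0 = dphi s * (1 - 0).
  apply: MVT => //; apply: derivable_within_continuous => s _.
  by case: (dE s).
have : dphi s <= 0.
  rewrite /dphi subr_le0 /c.
  have -> : dot (grad f (x + s *: h)) h - dot (grad f x) h =
    dot (grad f (x + s *: h) - grad f x) h.
    by rewrite dotDl (dotC (- _)) dotNr (dotC h).
  apply: le_trans (dot_le_enorm _ _) _.
  rewrite -enorm_sqr expr2 mulrA ler_wpM2r ?enorm_ge0//.
  apply: le_trans (gL _ _) _; rewrite -mulrA ler_wpM2l// addrAC subrr add0r.
  by rewrite /enorm sqnormZ sqrtrM ?sqr_ge0// sqrtr_sqr gtr0_norm.
move: E; rewrite /phi scale1r scale0r addr0 {1}/h (addrC x) subrK subr0 !mulr1.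
by rewrite !mul1r expr1n mul0r expr0n /= mulr0 -/c; lra.
Qed.

Lemma differentiable_sectionl a b (f : 'rV[R]_a -> 'rV[R]_b -> R) u v :
  (forall p, differentiable (fun q : 'rV[R]_a * 'rV[R]_b => f q.1 q.2) p) ->
  differentiable (fun u => f u v) u.
Proof.
move=> df; apply: (@differentiable_comp _ _ _ _ (fun u => (u, v))
  (fun q : 'rV[R]_a * 'rV[R]_b => f q.1 q.2)) => //.
Qed.

Lemma differentiable_sectionr a b (f : 'rV[R]_a -> 'rV[R]_b -> R) u v :
  (forall p, differentiable (fun q : 'rV[R]_a * 'rV[R]_b => f q.1 q.2) p) ->
  differentiable (f u) v.
Proof.
move=> df; apply: (@differentiable_comp _ _ _ _ (fun v => (u, v))
  (fun q : 'rV[R]_a * 'rV[R]_b => f q.1 q.2)) => //.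
Qed.

Section Average.
Context {n d0 : nat} {d : 'I_n -> nat}.
Context (F : forall i : 'I_n, 'rV[R]_d0 -> 'rV[R]_(d i) -> R).
Arguments F : clear implicits.
Hypothesis hFdiff : forall (i : 'I_n) (p : 'rV[R]_d0 * 'rV[R]_(d i)),
  differentiable (fun q : 'rV[R]_d0 * 'rV[R]_(d i) => F i q.1 q.2) p.

Let FavgE (V : forall i : 'I_n, 'rV[R]_(d i)) :
  (fun u => Favg F u V) = n%:R^-1 *: \sum_(i < n) (fun u => F i u (V i)).
Proof. by apply/funext => u; rewrite /Favg fctE; congr (_ * _); rewrite fct_sumE. Qed.

Lemma differentiable_Favg (V : forall i : 'I_n, 'rV[R]_(d i)) u :
  differentiable (fun u => Favg F u V) u.
Proof.
rewrite FavgE; apply: differentiableZ; apply: differentiable_sum => i.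
exact: differentiable_sectionl.
Qed.

Lemma gradFuE u (V : forall i : 'I_n, 'rV[R]_(d i)) :
  gradFu F u V = n%:R^-1 *: \sum_(i < n) gradu (F i) u (V i).
Proof.
have dF i : derivable (fun u => F i u (V i)) u =1 fun=> True.
  move=> v; apply/propext; split=> // _; apply: diff_derivable.
  exact: differentiable_sectionl.
apply/rowP => j; rewrite !mxE summxE FavgE deriveZ; last first.
  by apply: derivable_sum => i; rewrite dF.
rewrite derive_sum => [|i]; last by rewrite dF.
by congr (_ * _); apply: eq_bigr => i _; rewrite mxE.
Qed.

End Average.

End Descent.

(** * Measurability and independence *)

Section VectorMeasurability.
Context {R : realType} {dT : measure_display} {T : measurableType dT}.

Definition vmeasurable {k : nat} (X : T -> 'rV[R]_k) : Prop :=
  forall j, measurable_fun setT (fun w => X w 0 j).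

Lemma ratr_row_approx k (x : 'rV[R]_k) (e : R) : 0 < e ->
  exists p : 'rV[rat]_k, forall j, `|ratr (p 0 j) - x 0 j| < e.
Proof.
move=> e0; have /choice [p hp] : forall j, exists q : rat, `|ratr q - x 0 j| < e.
  move=> j; have /rat_in_itvoo [q] : x 0 j - e < x 0 j + e by lra.
  by rewrite in_itv /= => h; exists q; rewrite ltr_norml; lra.
by exists (\row_j p j) => j; rewrite mxE.
Qed.

(* An open set of R^a x R^b is a countable union of rational boxes. *)
Lemma open_preimage_measurable a b (X : T -> 'rV[R]_a) (Y : T -> 'rV[R]_b)
    (O : set ('rV[R]_a * 'rV[R]_b)) : open O ->
  vmeasurable X -> vmeasurable Y -> measurable [set w | O (X w, Y w)].
Proof.
move=> oO mX mY.
pose box k (p : 'rV[rat]_k) (e : R) : set 'rV[R]_k :=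
  [set x | forall j, `|ratr (p 0 j) - x 0 j| < e].
pose B (i : 'rV[rat]_a * 'rV[rat]_b * nat) : set ('rV[R]_a * 'rV[R]_b) :=
  [set q | box _ i.1.1 i.2.+1%:R^-1 q.1 /\ box _ i.1.2 i.2.+1%:R^-1 q.2].
have mbox k (Z : T -> 'rV[R]_k) p e : vmeasurable Z -> measurable [set w | box k p e (Z w)].
  move=> mZ; rewrite (_ : mkset _ = \bigcap_(j in [set: 'I_k])
      [set w | `|ratr (p 0 j) - Z w 0 j| < e]); last first.
    by apply/seteqP; split => [w h j _|w h j]; [exact: (h j)|exact: (h j I)].
  apply: fin_bigcap_measurable => [|j _]; first exact: finite_finset.
  rewrite -[X in measurable X]setTI.
  have : measurable_fun setT (fun w => `|ratr (p 0 j) - Z w 0 j| < e).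
    apply: measurable_fun_ltr => //; apply: measurableT_comp => //.
    by apply: measurable_funB => //; exact: mZ.
  by move=> /(_ measurableT [set true]); apply.
pose mB i := (if pselect (B i `<=` O) then [set w | B i (X w, Y w)] else set0) : set T.
rewrite (_ : mkset _ = \bigcup_i mB i).
  apply: countable_bigcupT_measurable; first exact: countableP.
  move=> i; rewrite /mB; case: pselect => [h|h]; last exact: measurable0.
  by apply: measurableI; exact: mbox.
apply/seteqP; split => [w /= Ow|w [i _]]; last first.
  by rewrite /mB; case: pselect => // h /= Bw; exact: h.
move: oO; rewrite openE => /(_ _ Ow) /nbhs_ballP [e /= e0 he].
(* The radius 1/(k+1) is below e/2, so a box of that radius whose centre is this close to the point
   lies in the e-ball around the point. *)
pose k := Num.truncn (2 / e).
have ke : k.+1%:R^-1 < e / 2.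
  by rewrite -[e / 2]invf_div ltf_pV2 ?posrE ?divr_gt0// truncnS_gt.
have k0 : 0 < k.+1%:R^-1 :> R by rewrite invr_gt0 ltr0n.
have [p hp] := ratr_row_approx (X w) k0.
have [q hq] := ratr_row_approx (Y w) k0.
exists (p, q, k) => //; rewrite /mB; case: pselect => [h|]; first by split.
case=> -[x y] [/= hx hy]; apply: he.
have key (r u v : R) : `|r - u| < k.+1%:R^-1 -> `|r - v| < k.+1%:R^-1 -> ball u e v.
  move=> h1 h2; rewrite -ball_normE /ball_ /=.
  rewrite (_ : u - v = (r - v) - (r - u)); last by ring.
  apply: le_lt_trans (ler_normB _ _) _.
  by rewrite (splitr e) ltrD// (lt_trans _ ke).
split; split=> // i j /=.
  by rewrite !ord1; apply: key (hp j) (hx j).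
by rewrite !ord1; apply: key (hq j) (hy j).
Qed.

Lemma measurable_fun_open (f : T -> R) :
  (forall O : set R, open O -> measurable (f @^-1` O)) -> measurable_fun setT f.
Proof.
move=> h; apply: (measurability (@RGenOpens.G R)) => [|_ [_ [x [y ->]] <-]].
  exact: RGenOpens.measurableE.
by rewrite setTI; apply: h; exact: interval_open.
Qed.

Lemma measurable_continuous2 a b (f : 'rV[R]_a * 'rV[R]_b -> R)
    (X : T -> 'rV[R]_a) (Y : T -> 'rV[R]_b) :
  continuous f -> vmeasurable X -> vmeasurable Y ->
  measurable_fun setT (fun w => f (X w, Y w)).
Proof.
move=> cf mX mY; apply: measurable_fun_open => O oO.
by apply: (open_preimage_measurable (O := f @^-1` O)) => //; apply: open_comp.
Qed.

Lemma jointly_measurable_comp (dZ : measure_display) (Z : measurableType dZ) a b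
    (f : 'rV[R]_a * 'rV[R]_b * Z -> R) (X : T -> 'rV[R]_a) (Y : T -> 'rV[R]_b)
    (z : T -> Z) :
  jointly_measurable f -> vmeasurable X -> vmeasurable Y -> measurable_fun setT z ->
  measurable_fun setT (fun w => f (X w, Y w, z w)).
Proof.
move=> jf mX mY mz; apply: measurable_fun_open => O /jf.
set h := fun w => (X w, Y w, z w).
(* Good sets: those with measurable preimage form a sigma-algebra, so only rectangles need
   checking. *)
suff : forall A, <<s [set W | exists U V B, [/\ open U, open V, measurable B &
    W = (U `*` V) `*` B]] >> A -> measurable (h @^-1` A) by move/[apply].
apply: smallest_sub => [|_ [U [V [B [oU oV mB ->]]]]].
  split=> [|A mA|A mA]; first by rewrite preimage_set0.
    by rewrite setTD preimage_setC; exact: measurableC.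
  by rewrite preimage_bigcup; exact: bigcupT_measurable.
rewrite (_ : h @^-1` _ = [set w | (U `*` V) (X w, Y w)] `&` z @^-1` B)//.
apply: measurableI; last by rewrite -[X in measurable X]setTI; exact: mz.
apply: open_preimage_measurable => //.
rewrite (_ : U `*` V = fst @^-1` U `&` snd @^-1` V)//.
apply: openI; apply: open_comp => // x _.
  exact: cvg_fst.
exact: cvg_snd.
Qed.

End VectorMeasurability.

Lemma in_bigsetI (T : Type) (I : eqType) (s : seq I) (B : I -> set T) w :
  (\big[setI/setT]_(j <- s) B j) w <-> forall j, j \in s -> B j w.
Proof.
elim: s => [|i s IH]; first by rewrite big_nil.
rewrite big_cons; split=> [[Bi /IH h] j|h].
  by rewrite inE => /orP[/eqP ->//|/h].
split; first by apply: h; rewrite mem_head.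
by apply/IH => j js; apply: h; rewrite inE js orbT.
Qed.

(** * Independence of one ingredient from the others *)

Section FreshSample.
Context {R : realType} {dO : measure_display} {Omega : measurableType dO}.
Context (P : probability Omega R) {I : eqType} (E : I -> set (set Omega)).
Hypothesis EI : forall j, setI_closed (E j).
Hypothesis ET : forall j, E j setT.
Hypothesis Em : forall j A, E j A -> measurable A.
Hypothesis indep : mutually_independent P E.

Definition cylinders (J : set I) : set (set Omega) :=
  [set A | exists (s : seq I) (B : I -> set Omega),
    [/\ uniq s, forall j, j \in s -> J j, forall j, j \in s -> E j (B j)
      & A = \big[setI/setT]_(j <- s) B j]].

(* Omega with the sigma-algebra generated by the ingredients indexed by J. *)
Definition past (J : set I) := g_sigma_algebraType (cylinders J).

Lemma cylindersI J : setI_closed (cylinders J).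
Proof.
move=> _ _ [s [B [us sJ sB ->]]] [s' [B' [us' sJ' sB' ->]]].
(* The two index lists are merged; an index missing from one of them contributes the full set. *)
pose C j := (if j \in s then B j else setT) `&` (if j \in s' then B' j else setT).
exists (undup (s ++ s')), C; split.
- exact: undup_uniq.
- by move=> j; rewrite mem_undup mem_cat => /orP[/sJ|/sJ'].
- move=> j _; apply: EI; case: ifPn => // js; [exact: sB|exact: sB'].
- apply/seteqP; split=> w.
    move=> [/in_bigsetI h /in_bigsetI h']; apply/in_bigsetI => j _.
    by split; case: ifPn => // js; [exact: h|exact: h'].
  move=> /in_bigsetI h; split; apply/in_bigsetI => j js;
    by have [] := h j; rewrite ?mem_undup ?mem_cat ?js ?orbT.
Qed.

Lemma cylindersT J : cylinders J setT.
Proof. by exists [::], (fun=> setT); split; rewrite ?big_nil. Qed.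

Lemma cylinders_measurable J : cylinders J `<=` measurable.
Proof.
move=> _ [s [B [_ _ sB ->]]]; rewrite big_seq.
by apply: bigsetI_measurable => j /sB /Em.
Qed.

Lemma past_measurable J (A : set Omega) : <<s cylinders J >> A -> measurable A.
Proof.
apply: smallest_sub; [exact: sigma_algebra_measurable|exact: cylinders_measurable].
Qed.

Lemma past_generator J j (A : set Omega) : J j -> E j A -> <<s cylinders J >> A.
Proof.
move=> Jj EA; apply: sub_sigma_algebra; exists [:: j], (fun=> A); split=> //.
- by move=> i; rewrite inE => /eqP ->.
- by move=> i; rewrite inE => /eqP ->.
- by rewrite big_seq1.
Qed.

Lemma past_measurable_fun J d (T : measurableType d) (f : Omega -> T) :
  measurable_fun (setT : set (past J)) f -> measurable_fun (setT : set Omega) f.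
Proof. by move=> mf _ A mA; apply: (@past_measurable J); exact: mf. Qed.

(** Dynkin's uniqueness theorem: A |-> P(A and B) and A |-> P(A) P(B) are finite measures that agree
    on the cylinders, a pi-system generating the past. On a cylinder, mutual independence is applied
    to its index list with j0 prepended. *)
Lemma past_indep J j0 (A B : set Omega) : ~ J j0 ->
  <<s cylinders J >> A -> E j0 B -> P (A `&` B) = (P A * P B)%E.
Proof.
move=> nJ + EB; have mB := Em EB.
have PB0 : 0 <= fine (P B) by rewrite fine_ge0.
pose m1 : {measure set Omega -> \bar R} := mrestr P mB.
pose m2 : {measure set Omega -> \bar R} := mscale (NngNum PB0) P.
suff h : forall A, <<s cylinders J >> A -> m1 A = m2 A.
  move/h; rewrite /m1 /m2 /= /mrestr /mscale /= => ->.
  by rewrite fineK ?fin_num_measure// muleC.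
apply: (g_sigma_algebra_measure_unique (cylinders J) (@cylinders_measurable J)
  (fun=> setT)).
- by move=> _; exact: cylindersT.
- by rewrite bigcup_const//; exists 0%N.
- exact: cylindersI.
- move=> _ [s [B' [us sJ sB ->]]]; rewrite /m1 /m2 /= /mrestr /mscale /=.
  have j0s : j0 \notin s by apply/negP => /sJ.
  pose C j := if j == j0 then B else B' j.
  have sC j : j \in s -> C j = B' j.
    by move=> js; rewrite /C; case: eqP => // e; rewrite -e js in j0s.
  have := indep (J := j0 :: s) _ (A := C); rewrite /= j0s us => /(_ isT).
  have C0 : C j0 = B by rewrite /C eqxx.
  rewrite !big_cons C0.
  have -> : \big[setI/setT]_(j <- s) C j = \big[setI/setT]_(j <- s) B' j.
    by apply: eq_big_seq => j; exact: sC.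
  have -> : \prod_(j <- s) fine (P (C j)) = \prod_(j <- s) fine (P (B' j)).
    by apply: eq_big_seq => j /sC ->.
  have -> : P (\big[setI/setT]_(j <- s) B' j) = (\prod_(j <- s) fine (P (B' j)))%:E.
    by apply: indep.
  rewrite setIC EFinM; apply => j; rewrite inE => /orP[/eqP ->|js].
    by rewrite C0.
  by rewrite sC//; exact: sB.
- move=> k; rewrite /m1 /= /mrestr setTI.
  exact: le_lt_trans (probability_le1 P mB) (ltry _).
Qed.

Context {J : set I} {j0 : I} {dZ : measure_display} {Z : measurableType dZ}.
Context {z : Omega -> Z} {D : probability Z R}.
Hypothesis nJ : ~ J j0.
Hypothesis mz : measurable_fun setT z.
Hypothesis zE : forall B, measurable B -> E j0 (z @^-1` B).
Hypothesis zD : forall B, measurable B -> P (z @^-1` B) = D B.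

(** The identity onto the coarser sigma-algebra. Its law is P restricted to the past, which makes
    the past a factor of a product space. *)
Let idJ : Omega -> past J := fun w => w.
Let midJ : measurable_fun setT idJ.
Proof. by move=> _ A mA; rewrite setTI; exact: past_measurable mA. Qed.
Let idJm := isMeasurableFun.Build _ _ _ _ _ midJ.
Let idJp : {mfun Omega >-> past J} := HB.pack idJ idJm.
Let PJ : probability (past J) R := distribution P idJp.

Let idz : Omega -> (past J * Z)%type := fun w => (w, z w).
Let midz : measurable_fun setT idz.
Proof. exact: measurable_fun_pair. Qed.
Let idzm := isMeasurableFun.Build _ _ _ _ _ midz.
Let idzp : {mfun Omega >-> (past J * Z)%type} := HB.pack idz idzm.
Let Pz : probability (past J * Z)%type R := distribution P idzp.

(** Product measures are determined by rectangles, where the claim is [past_indep]. *)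
Let prodE (A : set (past J * Z)) : measurable A -> Pz A = (PJ \x D)%E A.
Proof.
move=> mA; apply/esym; apply: product_measure_unique mA => A1 A2 mA1 mA2.
rewrite /Pz /PJ /distribution /pushforward /= -zD//.
by rewrite -(past_indep nJ)//; exact: zE.
Qed.

(* The joint law of the past J and of z is the product of P, restricted to the
   past, and D. *)
Lemma fresh_tonelli (h : past J * Z -> \bar R) : measurable_fun setT h ->
  (forall p, 0 <= h p)%E ->
  (\int[P]_w h (w, z w) = \int[P]_w \int[D]_y h (w, y))%E.
Proof.
move=> mh h0.
have := @ge0_integral_distribution _ _ _ _ _ P idzp h mh h0.
rewrite /= => <-; rewrite (eq_measure_integral (PJ \x D)%E) => [|A mA _]; last first.
  exact: prodE.
rewrite fubini_tonelli1//.
rewrite (@ge0_integral_distribution _ _ _ _ _ P idJp)//.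
  exact: measurable_fun_fubini_tonelli_F.
by move=> w; exact: integral_ge0.
Qed.

Lemma fresh_fubini (h : past J * Z -> \bar R) : measurable_fun setT h ->
  P.-integrable setT (fun w => h (w, z w)) ->
  (\int[P]_w h (w, z w) = \int[P]_w \int[D]_y h (w, y))%E.
Proof.
move=> mh ih.
have := @integral_distribution _ _ _ _ _ P idzp h mh ih.
rewrite /= => <-; rewrite (eq_measure_integral (PJ \x D)%E) => [|A mA _]; last first.
  exact: prodE.
(* Fubini for the product measure needs integrability there; it is transported from P through the
   absolute value, since the joint law is the product. *)
have iprod : (PJ \x D)%E.-integrable setT h.
  apply/integrableP; split=> //.
  rewrite (eq_measure_integral Pz) => [|A mA _]; last exact: (esym (prodE mA)).
  case/integrableP: ih => _; apply: le_lt_trans.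
  rewrite (@ge0_integral_distribution _ _ _ _ _ P idzp (abse \o h))//.
    exact: measurableT_comp.
  by move=> p; exact: abse_ge0.
rewrite -integral12_prod_meas1//.
have iF := integrable_fubini_F iprod.
rewrite (@integral_distribution _ _ _ _ _ P idJp)//; first exact: measurable_int iF.
case/integrableP: iF => mF iF; apply/integrableP; split.
  exact: past_measurable_fun mF.
apply: le_lt_trans iF.
rewrite (@ge0_integral_distribution _ _ _ _ _ P idJp (abse \o _))//.
  exact: measurableT_comp.
by move=> p; exact: abse_ge0.
Qed.

End FreshSample.

(** * Square-integrable random vectors *)

Section Expectation.
Context {R : realType} {dT : measure_display} {T : measurableType dT}.
Context (P : probability T R).

Implicit Types f g : T -> R.

Definition L1 (f : T -> R) : Prop := P.-integrable setT (EFin \o f).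
Definition expect (f : T -> R) : R := \int[P]_w f w.
Definition L2 (f : T -> R) : Prop :=
  measurable_fun setT f /\ L1 (fun w => f w ^+ 2).
Definition vL2 {k : nat} (X : T -> 'rV[R]_k) : Prop :=
  forall j, L2 (fun w => X w 0 j).

Lemma L1_measurable f : L1 f -> measurable_fun setT f.
Proof. by move=> /measurable_int /measurable_EFinP. Qed.

Lemma L1_ext f g : f =1 g -> L1 f -> L1 g.
Proof. by move=> /funext ->. Qed.

Lemma L1D f g : L1 f -> L1 g -> L1 (fun w => f w + g w).
Proof.
by move=> h1 h2; rewrite /L1 (_ : _ \o _ = (EFin \o f) \+ (EFin \o g))%E //;
  apply: integrableD.
Qed.

Lemma L1Z a f : L1 f -> L1 (fun w => a * f w).
Proof.
move=> h1; rewrite /L1 (_ : _ \o _ = (fun w => a%:E * (EFin \o f) w)%E)//.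
exact: integrableZl.
Qed.

Lemma L1N f : L1 f -> L1 (fun w => - f w).
Proof. by move=> h1; apply: L1_ext (L1Z (-1) h1) => w; rewrite mulN1r. Qed.

Lemma L1B f g : L1 f -> L1 g -> L1 (fun w => f w - g w).
Proof. by move=> h1 /L1N; exact: L1D. Qed.

Lemma L1_cst a : L1 (fun=> a).
Proof. exact: finite_measure_integrable_cst. Qed.

Lemma L1_sum (I : Type) (s : seq I) (Q : pred I) (f : I -> T -> R) :
  (forall i, L1 (f i)) -> L1 (fun w => \sum_(i <- s | Q i) f i w).
Proof.
move=> h; elim: s => [|i s IH].
  by apply: L1_ext (L1_cst 0) => w; rewrite big_nil.
have [Qi|nQi] := boolP (Q i).
  by apply: L1_ext (L1D (h i) IH) => w; rewrite big_cons Qi.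
by apply: L1_ext IH => w; rewrite big_cons (negbTE nQi).
Qed.

Lemma L1_le f g : measurable_fun setT f -> (forall w, `|f w| <= g w) -> L1 g -> L1 f.
Proof.
move=> mf fg; apply: le_integrable => //; first exact/measurable_EFinP.
by move=> w _ /=; rewrite lee_fin (le_trans (fg w))// ler_norm.
Qed.

Lemma expect_ext f g : f =1 g -> expect f = expect g.
Proof. by move=> /funext ->. Qed.

Lemma expectD f g : L1 f -> L1 g -> expect (fun w => f w + g w) = expect f + expect g.
Proof. by move=> h1 h2; apply: RintegralD. Qed.

Lemma expectZ a f : L1 f -> expect (fun w => a * f w) = a * expect f.
Proof. by move=> h1; apply: RintegralZl. Qed.

Lemma expectN f : L1 f -> expect (fun w => - f w) = - expect f.
Proof.
by move=> h1; rewrite -mulN1r -expectZ//; apply: expect_ext => w; rewrite mulN1r.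
Qed.

Lemma expectB f g : L1 f -> L1 g -> expect (fun w => f w - g w) = expect f - expect g.
Proof. by move=> h1 h2; rewrite expectD ?expectN//; exact: L1N. Qed.

Lemma expect_cst a : expect (fun=> a) = a.
Proof. rewrite /expect Rintegral_cst//. by rewrite (congr1 fine (probability_setT P)) mulr1. Qed.

Lemma expect_sum (I : Type) (s : seq I) (Q : pred I) (f : I -> T -> R) :
  (forall i, L1 (f i)) ->
  expect (fun w => \sum_(i <- s | Q i) f i w) = \sum_(i <- s | Q i) expect (f i).
Proof.
move=> h; elim: s => [|i s IH].
  rewrite big_nil -[RHS](expect_cst 0); apply: expect_ext => w.
  by rewrite big_nil.
rewrite big_cons -IH; have [Qi|nQi] := boolP (Q i).
  rewrite -expectD//; last exact: L1_sum.
  by apply: expect_ext => w; rewrite big_cons Qi.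
by apply: expect_ext => w; rewrite big_cons (negbTE nQi).
Qed.

Lemma expect_le f g : L1 f -> L1 g -> (forall w, f w <= g w) -> expect f <= expect g.
Proof. by move=> h1 h2 h; apply: le_Rintegral. Qed.

Lemma expectE f : L1 f -> ((expect f)%:E = \int[P]_w (f w)%:E)%E.
Proof. by move=> h; rewrite /expect /Rintegral fineK//; exact: integrable_fin_num. Qed.

(** Replacing f by min(f, g), which equals f on [A], reduces the claim to a bound valid everywhere.
    It is needed because a sampled set has m elements only almost surely. *)
Lemma expect_le_ae f g (A : set T) : measurable A -> P A = 1%E ->
  L1 f -> L1 g -> (forall w, A w -> f w <= g w) -> expect f <= expect g.
Proof.
move=> mA PA hf hg fg.
pose f' w := Num.min (f w) (g w).
have mf' : measurable_fun setT f'.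
  by apply: measurable_minr; exact: L1_measurable.
have f'E : ae_eq P setT (EFin \o f) (EFin \o f').
  exists (~` A); split; first exact: measurableC.
    apply: (etrans (probability_setC P mA)).
    by apply: (etrans (congr1 (fun x => 1 - x)%E PA)); rewrite subee.
  apply: subsetC => w Aw /= _; rewrite /f'; congr EFin.
  by apply/esym/min_idPl; exact: fg.
have hf' : L1 f'.
  apply/integrableP; split; first exact/measurable_EFinP.
  have -> : (\int[P]_w `|(EFin \o f') w| = \int[P]_w `|(EFin \o f) w|)%E.
    apply: ae_eq_integral => //.
    - by apply: measurableT_comp => //; apply/measurable_EFinP.
    - by apply: measurableT_comp => //; apply/measurable_EFinP/L1_measurable.
    - by apply: filterS f'E => w /= h /h [->].
  by case/integrableP: hf.
have -> : expect f = expect f'.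
  rewrite /expect /Rintegral; congr fine; apply: ae_eq_integral => //.
    exact/measurable_EFinP/L1_measurable.
  exact/measurable_EFinP.
by apply: expect_le => // w; rewrite /f' ge_min lexx orbT.
Qed.

Lemma L2_cst a : L2 (fun=> a).
Proof. by split; [exact: measurable_cst|exact: L1_cst]. Qed.

Lemma L2D f g : L2 f -> L2 g -> L2 (fun w => f w + g w).
Proof.
move=> [mf hf] [mg hg]; split; first exact: measurable_funD.
apply: L1_le (L1Z 2 (L1D hf hg)).
  by apply: measurable_funX; exact: measurable_funD.
move=> w; rewrite ger0_norm ?sqr_ge0//.
by have := sqr_ge0 (f w - g w); rewrite !expr2; lra.
Qed.

Lemma L2Z a f : L2 f -> L2 (fun w => a * f w).
Proof.
move=> [mf hf]; split; first exact: measurable_funM.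
by apply: L1_ext (L1Z (a ^+ 2) hf) => w; rewrite exprMn.
Qed.

Lemma L2M f g : L2 f -> L2 g -> L1 (fun w => f w * g w).
Proof.
move=> [mf hf] [mg hg]; apply: L1_le (L1D hf hg); first exact: measurable_funM.
move=> w; have := sqr_ge0 (f w - g w); have := sqr_ge0 (f w + g w).
have := sqr_ge0 (f w); have := sqr_ge0 (g w).
by rewrite ler_norml !expr2; nra.
Qed.

Section Vectors.
Context {k : nat}.
Implicit Types X Y : T -> 'rV[R]_k.

Lemma vL2_cst (x : 'rV[R]_k) : vL2 (fun=> x).
Proof. by move=> j; exact: L2_cst. Qed.

Lemma vL2_ext X Y : X =1 Y -> vL2 X -> vL2 Y.
Proof. by move=> /funext ->. Qed.

Lemma vL2D X Y : vL2 X -> vL2 Y -> vL2 (fun w => X w + Y w).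
Proof. by move=> hX hY j; under eq_fun do rewrite mxE; exact: L2D. Qed.

Lemma vL2Z a X : vL2 X -> vL2 (fun w => a *: X w).
Proof. by move=> hX j; under eq_fun do rewrite mxE; exact: L2Z. Qed.

Lemma vL2B X Y : vL2 X -> vL2 Y -> vL2 (fun w => X w - Y w).
Proof.
move=> hX hY; apply: vL2_ext (vL2D hX (vL2Z (-1) hY)) => w.
by rewrite scaleN1r.
Qed.

Lemma vL2_sum (I : Type) (s : seq I) (Q : pred I) (X : I -> T -> 'rV[R]_k) :
  (forall i, vL2 (X i)) -> vL2 (fun w => \sum_(i <- s | Q i) X i w).
Proof.
move=> h; elim: s => [|i s IH].
  by apply: vL2_ext (vL2_cst 0) => w; rewrite big_nil.
have [Qi|nQi] := boolP (Q i).
  by apply: vL2_ext (vL2D (h i) IH) => w; rewrite big_cons Qi.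
by apply: vL2_ext IH => w; rewrite big_cons (negbTE nQi).
Qed.

Lemma vL2_measurable X : vL2 X -> vmeasurable X.
Proof. by move=> h j; case: (h j). Qed.

Lemma L1_dot X Y : vL2 X -> vL2 Y -> L1 (fun w => dot (X w) (Y w)).
Proof. by move=> hX hY; apply: L1_sum => j; exact: L2M. Qed.

Lemma L1_sqnorm X : vL2 X -> L1 (fun w => sqnorm (X w)).
Proof. by move=> h; apply: L1_ext (L1_dot h h) => w; rewrite sqnormE. Qed.

Lemma vL2_le X (f : T -> R) : vmeasurable X -> (forall w, sqnorm (X w) <= f w) ->
  L1 f -> vL2 X.
Proof.
move=> mX h hf j; split; first exact: mX.
apply: L1_le hf; first by apply: measurable_funX; exact: mX.
move=> w; rewrite ger0_norm ?sqr_ge0//; apply: le_trans (h w).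
by rewrite /sqnorm (bigD1 j)//= lerDl; nneg.
Qed.

End Vectors.

Lemma vmeasurable_sqnorm k (X : T -> 'rV[R]_k) :
  vmeasurable X -> measurable_fun setT (fun w => sqnorm (X w)).
Proof. by move=> mX; apply: measurable_sum => j; apply: measurable_funX; exact: mX. Qed.

Lemma vmeasurableD k (X Y : T -> 'rV[R]_k) :
  vmeasurable X -> vmeasurable Y -> vmeasurable (fun w => X w + Y w).
Proof.
by move=> hX hY j; under eq_fun do rewrite mxE; apply: measurable_funD; [exact: hX|exact: hY].
Qed.

Lemma vmeasurableZ k a (X : T -> 'rV[R]_k) :
  vmeasurable X -> vmeasurable (fun w => a *: X w).
Proof.
by move=> hX j; under eq_fun do rewrite mxE; apply: measurable_funM => //; exact: hX.
Qed.

Lemma vmeasurableB k (X Y : T -> 'rV[R]_k) :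
  vmeasurable X -> vmeasurable Y -> vmeasurable (fun w => X w - Y w).
Proof.
by move=> hX hY j; under eq_fun do rewrite !mxE; apply: measurable_funB; [exact: hX|exact: hY].
Qed.

Lemma vmeasurable_continuous a b k (g : 'rV[R]_a -> 'rV[R]_b -> 'rV[R]_k) X Y :
  continuous (fun q : 'rV[R]_a * 'rV[R]_b => g q.1 q.2) ->
  vmeasurable X -> vmeasurable Y -> vmeasurable (fun w : T => g (X w) (Y w)).
Proof.
move=> cg mX mY j.
apply: (measurable_continuous2 (f := fun q => g q.1 q.2 0 j)) => // q.
apply: (@continuous_comp _ _ _ (fun q => g q.1 q.2) (fun M : 'rV[R]_k => M 0 j)).
  exact: cg.
exact: coord_continuous.
Qed.

End Expectation.

(** * Mean and variance of the gradient noise at a fresh sample *)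

Section FreshNoise.
Context {R : realType} {dO : measure_display} {Omega : measurableType dO}.
Context (P : probability Omega R) {I : eqType} (E : I -> set (set Omega)).
Hypothesis EI : forall j, setI_closed (E j).
Hypothesis ET : forall j, E j setT.
Hypothesis Em : forall j A, E j A -> measurable A.
Hypothesis indep : mutually_independent P E.
Context {J : set I} {j0 : I} {dZ : measure_display} {Z : measurableType dZ}.
Context {z : Omega -> Z} {D : probability Z R}.
Hypothesis nJ : ~ J j0.
Hypothesis mz : measurable_fun setT z.
Hypothesis zE : forall B, measurable B -> E j0 (z @^-1` B).
Hypothesis zD : forall B, measurable B -> P (z @^-1` B) = D B.

Let pastJ := past E J.

Lemma past_vmeasurable k (X : Omega -> 'rV[R]_k) :
  vmeasurable (X : pastJ -> _) -> vmeasurable X.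
Proof. by move=> mX j; apply: past_measurable_fun (mX j). Qed.

Context {a b k : nat} (G : 'rV[R]_a -> 'rV[R]_b -> Z -> 'rV[R]_k).
Context (g : 'rV[R]_a -> 'rV[R]_b -> 'rV[R]_k) (s : R).
Hypothesis mG : forall j, jointly_measurable
  (fun p : 'rV[R]_a * 'rV[R]_b * Z => G p.1.1 p.1.2 p.2 0 j).
Hypothesis cg : continuous (fun q : 'rV[R]_a * 'rV[R]_b => g q.1 q.2).
Hypothesis meanG : forall u v j, D.-integrable setT (fun y => (G u v y 0 j)%:E) /\
  (\int[D]_y (G u v y 0 j)%:E = (g u v 0 j)%:E)%E.
Hypothesis varG : forall u v,
  (\int[D]_y (sqnorm (G u v y - g u v))%:E <= (s ^+ 2)%:E)%E.
Context (X : Omega -> 'rV[R]_a) (Y : Omega -> 'rV[R]_b).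
Hypothesis mX : vmeasurable (X : pastJ -> _).
Hypothesis mY : vmeasurable (Y : pastJ -> _).

Let xi w := G (X w) (Y w) (z w) - g (X w) (Y w).

Lemma vmeasurable_noise dT (T : measurableType dT) (X' : T -> 'rV[R]_a)
    (Y' : T -> 'rV[R]_b) (z' : T -> Z) :
  vmeasurable X' -> vmeasurable Y' -> measurable_fun setT z' ->
  vmeasurable (fun w => G (X' w) (Y' w) (z' w) - g (X' w) (Y' w)).
Proof.
move=> mX' mY' mz'; apply: vmeasurableB; last exact: vmeasurable_continuous.
by move=> j; exact: (jointly_measurable_comp (mG j)).
Qed.

Let mfst k' (W : Omega -> 'rV[R]_k') : vmeasurable (W : pastJ -> _) ->
  vmeasurable (fun p : (pastJ * Z)%type => W p.1).
Proof. by move=> mW j; apply: (measurableT_comp (mW j)); exact: measurable_fst. Qed.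

Let mh : vmeasurable (fun p : (pastJ * Z)%type =>
  G (X p.1) (Y p.1) p.2 - g (X p.1) (Y p.1)).
Proof.
apply: vmeasurable_noise (mfst mX) (mfst mY) _; exact: measurable_snd.
Qed.

(** Tonelli rather than Fubini, because integrability of the noise is a consequence of this bound.
    The past freezes X and Y, and [varG] holds uniformly in them, so no moment of X or Y enters. *)
Let noise_le : (\int[P]_w (sqnorm (xi w))%:E <= (s ^+ 2)%:E)%E.
Proof.
pose h (p : (pastJ * Z)%type) :=
  (sqnorm (G (X p.1) (Y p.1) p.2 - g (X p.1) (Y p.1)))%:E.
have := @fresh_tonelli _ _ _ P _ E EI ET Em indep J j0 _ Z z D nJ mz zE zD h _ _.
rewrite /h /= => ->; last 2 first.
- by apply/measurable_EFinP; exact: vmeasurable_sqnorm.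
- by move=> p; rewrite lee_fin sqnorm_ge0.
apply: (@le_trans _ _ (\int[P]_w (s ^+ 2)%:E)%E); last first.
  by rewrite integral_cst// [X in (_ * X)%E](probability_setT P) mule1.
apply: ge0_le_integral => //.
- by move=> w _; apply: integral_ge0 => y _; rewrite lee_fin sqnorm_ge0.
- apply: (past_measurable_fun Em (J := J)).
  apply: (measurable_fun_fubini_tonelli_F h).
    by apply/measurable_EFinP; exact: vmeasurable_sqnorm.
  by move=> p; rewrite lee_fin sqnorm_ge0.
Qed.

Lemma noise_vL2 : vL2 P xi.
Proof.
have mxi : vmeasurable xi.
  by apply: vmeasurable_noise => //; exact: past_vmeasurable.
apply: (vL2_le mxi (fun w => lexx _)); apply/integrableP; split.
  by apply/measurable_EFinP; exact: vmeasurable_sqnorm.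
apply: le_lt_trans (ltry (s ^+ 2)); apply: le_trans noise_le.
apply: ge0_le_integral => //.
- by apply: measurableT_comp => //; apply/measurable_EFinP; exact: vmeasurable_sqnorm.
- by apply/measurable_EFinP; exact: vmeasurable_sqnorm.
- by move=> w _; rewrite /= lee_fin ger0_norm ?sqnorm_ge0.
Qed.

Lemma noise_variance : expect P (fun w => sqnorm (xi w)) <= s ^+ 2.
Proof. by rewrite -lee_fin expectE//; exact: L1_sqnorm noise_vL2. Qed.

(** Once the past is fixed, W, X and Y are constants of the inner integral and each coordinate of
    the noise is centred. [noise_vL2] supplies the integrability that Fubini requires. *)
Lemma noise_mean (W : Omega -> 'rV[R]_k) : vmeasurable (W : pastJ -> _) ->
  vL2 P W -> expect P (fun w => dot (W w) (xi w)) = 0.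
Proof.
move=> mW hW; rewrite /expect /Rintegral.
pose h (p : (pastJ * Z)%type) :=
  (dot (W p.1) (G (X p.1) (Y p.1) p.2 - g (X p.1) (Y p.1)))%:E.
have := @fresh_fubini _ _ _ P _ E EI ET Em indep J j0 _ Z z D nJ mz zE zD h _ _.
rewrite /h /= => ->; last 2 first.
- apply/measurable_EFinP; apply: measurable_sum => j.
  by apply: measurable_funM; [exact: mfst|exact: mh].
- exact: L1_dot noise_vL2.
rewrite integral0_eq// => w _ /=.
have iG j : L1 D (fun y => G (X w) (Y w) y 0 j) by have [] := meanG (X w) (Y w) j.
have iGB j : L1 D (fun y => W w 0 j * (G (X w) (Y w) y - g (X w) (Y w)) 0 j).
  by apply: L1Z; under eq_fun do rewrite !mxE; apply: L1B => //; exact: L1_cst.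
rewrite -expectE; last exact: L1_sum.
rewrite expect_sum// big1// => j _.
rewrite expectZ; last first.
  by under eq_fun do rewrite !mxE; apply: L1B => //; exact: L1_cst.
under expect_ext do rewrite !mxE.
rewrite expectB ?expect_cst//; last exact: L1_cst.
have [_] := meanG (X w) (Y w) j; rewrite /expect /Rintegral => -> /=.
by rewrite subrr mulr0.
Qed.

End FreshNoise.

(** * Independence of the sampling indicators *)

Section Sampling.
Context {R : realType} {dO : measure_display} {Omega : measurableType dO}.
Context (P : probability Omega R) {I : eqType} (E : I -> set (set Omega)).
Hypothesis EI : forall j, setI_closed (E j).
Hypothesis ET : forall j, E j setT.
Hypothesis Em : forall j A, E j A -> measurable A.
Hypothesis indep : mutually_independent P E.
Context {J : set I} {j0 : I}.
Hypothesis nJ : ~ J j0.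

(** The Boolean c is itself regarded as a fresh sample, with its own law on [bool]; the
    factorisation is then Fubini for b * f. *)
Lemma expect_indep (c : Omega -> bool) (f : Omega -> R) :
  (forall B, E j0 (c @^-1` B)) ->
  measurable_fun setT (f : past E J -> R) -> L1 P f ->
  L1 P (fun w => (c w)%:R * f w) /\
  expect P (fun w => (c w)%:R * f w) = fine (P (c @^-1` [set true])) * expect P f.
Proof.
move=> cE mf hf.
have mc : measurable_fun setT c.
  by move=> _ B _; rewrite setTI; apply: Em.
have mcR : measurable_fun setT (fun w => (c w)%:R : R).
  by apply: (measurableT_comp (f := fun b : bool => b%:R : R)).
have hcf : L1 P (fun w => (c w)%:R * f w).
  apply: (@L1_le _ _ _ P _ (fun w => `|f w|)).
  - by apply: measurable_funM => //; exact: L1_measurable hf.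
  - by move=> w; rewrite normrM normr_nat; case: (c w); rewrite ?mul1r ?mul0r.
  - exact: (integrable_abse hf).
split=> //.
pose cm := isMeasurableFun.Build _ _ _ _ _ mc.
pose cp : {mfun Omega >-> bool} := HB.pack c cm.
pose D : probability bool R := distribution P cp.
pose h (p : (past E J * bool)%type) := ((p.2)%:R * f p.1)%:E.
have := @fresh_fubini _ _ _ P _ E EI ET Em indep J j0 _ bool c D nJ mc _ _ h _ _.
rewrite /h /= {1}/expect /Rintegral => ->//; last first.
  apply/measurable_EFinP; apply: measurable_funM.
    exact: (measurableT_comp (f := fun b : bool => b%:R : R) _
      (@measurable_snd _ _ (past E J) bool)).
  exact: (measurableT_comp mf (@measurable_fst _ _ (past E J) bool)).
have hb : L1 D (fun b : bool => b%:R).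
  apply: (L1_le _ _ (L1_cst D 1)) => //.
  by case; rewrite /= ?normr1 ?normr0.
have -> : (fun w => \int[D]_y (y%:R * f w)%:E)%E =
    (fun w => (fine (P (c @^-1` [set true])) * f w)%:E).
  apply/funext => w; under eq_integral do rewrite mulrC.
  rewrite -(expectE (L1Z (f w) hb)) expectZ// mulrC; congr (_ * _)%:E.
  rewrite /expect /Rintegral; congr fine.
  transitivity (\int[D]_y (\1_[set true] y)%:E)%E.
    apply: eq_integral => y _; rewrite indicE; congr (_%:R)%:E.
    by case: y; [rewrite mem_set|rewrite memNset].
  by rewrite integral_indic// setIT.
exact: expectZ.
Qed.

End Sampling.

(** * One round of FedAlt *)

Section RoundAlgebra.
Context {R : realType}.
Context (eta p chi Lu Lv rho del kv ku : R).
Hypothesis eta0 : 0 < eta.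
Hypothesis eta1 : eta * (24 * (1 + rho ^+ 2)) <= 1.
Hypothesis p0 : 0 <= p.
Hypothesis p1 : p <= 1.
Hypothesis eta2 : 128 * chi ^+ 2 * (1 - p) * eta <= p.
Hypothesis eta3 : chi ^+ 2 * eta ^+ 2 <= p.
Hypothesis Lu0 : 0 < Lu.
Hypothesis Lv0 : 0 < Lv.
Hypothesis kv0 : 0 <= kv.
Hypothesis kv1 : kv <= 1.
Hypothesis ku0 : 0 <= ku.
Hypothesis ku1 : ku <= 1.

Let eta24 : eta <= 24^-1.
Proof. by move: eta1 (mulr_ge0 (ltW eta0) (sqr_ge0 rho)) => h1 h2; lra. Qed.

(* The one-round bound is cA + cB * sigma_v^2 + cC * sigma_u^2. *)
Definition cA : R := eta / Lu * del ^+ 2 *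
  ((2 * eta ^+ 2 + 24 * eta ^+ 3) * ku + 6 * (1 - p) * eta).
Definition cB : R := eta / Lv * (p * (2 * eta ^+ 2 * kv + 2 * eta) +
  2 * chi ^+ 2 * (1 - p) * eta + 10^-1 * chi ^+ 2 * eta ^+ 2).
Definition cC : R := eta / Lu * ((2 * eta ^+ 2 + 24 * eta ^+ 3) * ku + 6 * eta).

(** Dictionary, with all means over the devices: [sq] and [sqV] are the squared u-gradients at (u,
    vt) and (u, V), [H] is the diversity at (u, vt), [Gv] the mean squared v-gradient, [Nv] and [Nu]
    the mean squared noises, [FV] the change of F in the v-phase, [DU] the inner product of [gb]
    with the u-moves, [RE] the squared residuals, [QV] the squared v-moves, [IV] and [IU] the linear
    noise terms. The negative parts of [FV] and [DU] pay for everything else. *)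
Lemma round_algebra (sq sqV H Gv Nv Nu FV DU RE QV c IV IU : R) :
  0 <= sq -> 0 <= H -> 0 <= Gv -> 0 <= Nv -> 0 <= Nu ->
  H <= del ^+ 2 + rho ^+ 2 * sq ->
  FV <= eta / Lv * (- Gv / 2 + 2 * eta ^+ 2 * kv * (Gv + Nv) + 2 * eta * (Gv + Nv)) - IV ->
  DU <= eta / Lu * (- sq / 2 + 2 * eta ^+ 2 * ku * (sq + H + Nu)) - IU ->
  RE <= eta ^+ 2 / Lu ^+ 2 * (8 * eta ^+ 2 * ku * (sq + H + Nu) + 2 * Nu) ->
  QV <= 4 * (eta ^+ 2 / Lv ^+ 2) * (Gv + Nv) ->
  sqV <= 2 * sq + 2 * (chi ^+ 2 * (Lu * Lv)) * QV ->
  c <= 6 * (1 - p) * (eta ^+ 2 / Lu) ->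
  p * FV + DU + 3 * Lu * (RE + (eta / Lu) ^+ 2 * sq) + c * H
    + chi ^+ 2 * Lv / 2 * (1 - p) ^+ 2 * QV
  <= - (eta / 80) * (sqV / Lu + p / Lv * Gv) + cA + cB * Nv + cC * Nu
    - p * IV - IU.
Proof.
move=> sq0 H0 Gv0 Nv0 Nu0 hH hFV hDU hRE hQV hsqV hc.
move: eta0 eta1 eta2 eta3 eta24 kv1 ku1 p1 => e0 e1 e2' e3' e24 hkv1 hku1 hp1.
pose x := eta / Lu; pose y := eta / Lv.
have x0 : 0 < x by rewrite divr_gt0.
have y0 : 0 < y by rewrite divr_gt0.
have rho0 := sqr_ge0 rho; have chi0 := sqr_ge0 chi.
have e2 : eta ^+ 2 <= 576^-1 by rewrite expr2; nra.
have e20 : 0 <= eta ^+ 2 := sqr_ge0 _.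
have e30 : 0 <= eta ^+ 3 by rewrite exprn_ge0 // ltW.
have pc0 : 0 <= 1 - p by rewrite subr_ge0.
(* With eta <= 1/24, the factor 2 eta^2 kv + 2 eta is at most 9/100, and 1/2 - 9/100 = 41/100. *)
have T1 : p * FV <= y * p * (- (41 / 100) * Gv + (2 * eta ^+ 2 * kv + 2 * eta) * Nv) - p * IV.
  apply: le_trans (ler_wpM2l p0 hFV) _.
  have -> : p * (y * (- Gv / 2 + 2 * eta ^+ 2 * kv * (Gv + Nv) + 2 * eta * (Gv + Nv)) - IV)
    = y * p * (- Gv / 2 + 2 * eta ^+ 2 * kv * (Gv + Nv) + 2 * eta * (Gv + Nv)) - p * IV by ring.
  rewrite lerD2r; apply: ler_wpM2l; first by nneg.
  have h1 : eta ^+ 2 * kv <= 576^-1.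
    by apply: le_trans e2; rewrite ler_piMr.
  have h2 : (2 * (eta ^+ 2 * kv) + 2 * eta) * Gv <= 9 / 100 * Gv.
    by rewrite ler_wpM2r//; lra.
  lra.
have T2 : 3 * Lu * (RE + (eta / Lu) ^+ 2 * sq) <=
    x * (3 * eta * (8 * eta ^+ 2 * ku * (sq + H + Nu) + 2 * Nu) + 3 * eta * sq).
  apply: (@le_trans _ _ (3 * Lu * (eta ^+ 2 / Lu ^+ 2 *
     (8 * eta ^+ 2 * ku * (sq + H + Nu) + 2 * Nu) + (eta / Lu) ^+ 2 * sq))).
    by apply: ler_wpM2l; [nneg|rewrite lerD2r].
  by rewrite le_eqVlt; apply/orP; left; apply/eqP; rewrite /x; field; rewrite gt_eqF.
have T3 : c * H <= x * (6 * (1 - p) * eta * H).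
  have -> : x * (6 * (1 - p) * eta * H) = 6 * (1 - p) * (eta ^+ 2 / Lu) * H.
    by rewrite /x; field; rewrite gt_eqF.
  by rewrite ler_wpM2r.
(* The second step-size condition says 2 chi^2 (1 - p) eta <= p / 64, so the stale v_i of unsampled
   devices cost only a small part of the v-descent. *)
have T4 : chi ^+ 2 * Lv / 2 * (1 - p) ^+ 2 * QV <=
    y * (64^-1 * p * Gv + 2 * chi ^+ 2 * (1 - p) * eta * Nv).
  apply: (@le_trans _ _ (chi ^+ 2 * Lv / 2 * (1 - p) ^+ 2 * (4 * (eta ^+ 2 / Lv ^+ 2) * (Gv +
    Nv)))).
    by apply: ler_wpM2l => //; nneg.
  have -> : chi ^+ 2 * Lv / 2 * (1 - p) ^+ 2 * (4 * (eta ^+ 2 / Lv ^+ 2) * (Gv + Nv)) =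
    y * ((1 - p) * (2 * chi ^+ 2 * (1 - p) * eta) * (Gv + Nv)).
    by rewrite /y; field; rewrite gt_eqF.
  apply: ler_wpM2l; first by nneg.
  have w0 : 0 <= 2 * chi ^+ 2 * (1 - p) * eta by nneg.
  apply: (@le_trans _ _ ((2 * chi ^+ 2 * (1 - p) * eta) * (Gv + Nv))).
    by rewrite ler_wpM2r ?addr_ge0// ler_piMl// gerBl.
  rewrite mulrDr lerD2r; apply: ler_wpM2r => //; lra.
(* Passing from [sqV] to [sq] costs chi^2 eta^2 [Gv], at most p * [Gv] by the third condition. It
   enters the final sum divided by 80, hence the coefficient 1/10 in [cB]. *)
have T5 : eta * (sqV / Lu) <= x * (2 * sq) + y * (8 * p * Gv + 8 * chi ^+ 2 * eta ^+ 2 * Nv).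
  have -> : eta * (sqV / Lu) = x * sqV by rewrite /x; field; rewrite gt_eqF.
  apply: (@le_trans _ _ (x * (2 * sq + 2 * (chi ^+ 2 * (Lu * Lv)) *
    (4 * (eta ^+ 2 / Lv ^+ 2) * (Gv + Nv))))).
    apply: ler_wpM2l; first by nneg.
    apply: le_trans hsqV _; rewrite lerD2l; apply: ler_wpM2l => //; nneg.
  have -> : x * (2 * sq + 2 * (chi ^+ 2 * (Lu * Lv)) * (4 * (eta ^+ 2 / Lv ^+ 2) * (Gv + Nv)))
    = x * (2 * sq) + y * (8 * (chi ^+ 2 * eta ^+ 2) * Gv + 8 * chi ^+ 2 * eta ^+ 2 * Nv).
    by rewrite /x /y; field; rewrite !gt_eqF.
  rewrite lerD2l; apply: ler_wpM2l; first by nneg.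
  by rewrite lerD2r; apply: ler_wpM2r => //; lra.
pose k := (2 * eta ^+ 2 + 24 * eta ^+ 3) * ku.
have k0 : 0 <= k by rewrite /k; nneg.
(* One factor eta of [k] is paired with 1 + rho^2, where the first step-size condition gives
   1/24. *)
have ksq : k * (1 + rho ^+ 2) <= 100^-1.
  have -> : k * (1 + rho ^+ 2) = ku * ((2 * eta + 24 * eta ^+ 2) * (eta * (1 + rho ^+ 2))).
    by rewrite /k; ring.
  have a0 : 0 <= eta * (1 + rho ^+ 2) by nneg.
  have a1 : eta * (1 + rho ^+ 2) <= 24^-1 by lra.
  have b1 : 2 * eta + 24 * eta ^+ 2 <= 8^-1 by lra.
  have b0 : 0 <= 2 * eta + 24 * eta ^+ 2 by nneg.
  apply: (@le_trans _ _ ((2 * eta + 24 * eta ^+ 2) * (eta * (1 + rho ^+ 2)))).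
    by apply: ler_piMl => //; exact: mulr_ge0.
  by apply: le_trans (ler_pM b0 a0 b1 a1) _; lra.
have S1 : - sq / 2 + k * (sq + H + Nu) + 6 * eta * Nu + 3 * eta * sq + 6 * (1 - p) * eta * H
   <= - 5^-1 * sq + k * del ^+ 2 + 6 * (1 - p) * eta * del ^+ 2 + k * Nu + 6 * eta * Nu.
  have h1 : k * H <= k * (del ^+ 2 + rho ^+ 2 * sq) by rewrite ler_wpM2l.
  have h2 : 6 * (1 - p) * eta * H <= 6 * (1 - p) * eta * (del ^+ 2 + rho ^+ 2 * sq).
    by apply: ler_wpM2l => //; nneg.
  have h3 : k * (1 + rho ^+ 2) * sq <= 100^-1 * sq by rewrite ler_wpM2r.
  have h4 : (6 * (1 - p) * eta * rho ^+ 2 + 3 * eta) * sq <= 4^-1 * sq.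
    apply: ler_wpM2r => //.
    have h : 0 <= p * (eta * rho ^+ 2) by nneg.
    by lra.
  lra.
have SX := ler_wpM2l (ltW x0) S1.
have xsq : 0 <= x * sq by nneg.
have ypG : 0 <= y * p * Gv by nneg.
have ycN : 0 <= y * (chi ^+ 2 * eta ^+ 2 * Nv).
  by nneg.
have Efin : - (eta / 80) * (sqV / Lu + p / Lv * Gv) =
  - 80^-1 * (eta * (sqV / Lu)) - 80^-1 * (y * p * Gv) by rewrite /y; field; rewrite !gt_eqF.
rewrite Efin /cA /cB /cC -/x -/y -/k.
rewrite -/x in hDU T2; rewrite /k in SX *.
clear - T1 T2 T3 T4 T5 SX xsq ypG hDU; clearbody x y; lra.
Qed.

(** 6 is the coefficient of eta^2 in [cA] and [cC]. The quartic terms join the cubic ones because 24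
    eta <= 1. *)
Lemma noise_budget (su sv : R) :
  cA + cB * sv ^+ 2 + cC * su ^+ 2 <= 6 * (
    eta ^+ 2 * (del ^+ 2 / Lu * (1 - p) + su ^+ 2 / Lu + sv ^+ 2 * (p +
      chi ^+ 2 * (1 - p)) / Lv) +
    eta ^+ 3 * ((su ^+ 2 + del ^+ 2) / Lu * ku + sv ^+ 2 * p / Lv * kv +
      chi ^+ 2 * sv ^+ 2 / Lv)).
Proof.
move: eta0 eta24 => e0 e24.
have iu : 0 <= Lu^-1 by rewrite invr_ge0 ltW.
have iv : 0 <= Lv^-1 by rewrite invr_ge0 ltW.
have pc0 : 0 <= 1 - p by rewrite subr_ge0.
have e4 : 24 * eta ^+ 4 <= eta ^+ 3.
  rewrite (exprS eta 3) mulrA ler_piMl//; first by rewrite exprn_ge0 // ltW.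
  by lra.
have e3 : 0 <= eta ^+ 3 by rewrite exprn_ge0 // ltW.
have a1 : 24 * eta ^+ 4 * (Lu^-1 * ku * del ^+ 2) <= eta ^+ 3 * (Lu^-1 * ku * del ^+ 2).
  by apply: ler_wpM2r => //; nneg.
have a2 : 24 * eta ^+ 4 * (Lu^-1 * ku * su ^+ 2) <= eta ^+ 3 * (Lu^-1 * ku * su ^+ 2).
  by apply: ler_wpM2r => //; nneg.
have b1 : 0 <= eta ^+ 3 * (Lu^-1 * ku * del ^+ 2) by nneg.
have b2 : 0 <= eta ^+ 3 * (Lu^-1 * ku * su ^+ 2) by nneg.
have b3 : 0 <= eta ^+ 3 * (Lv^-1 * p * kv * sv ^+ 2) by nneg.
have b4 : 0 <= eta ^+ 2 * (Lv^-1 * p * sv ^+ 2) by nneg.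
have b5 : 0 <= eta ^+ 2 * (Lv^-1 * chi ^+ 2 * (1 - p) * sv ^+ 2) by nneg.
have b6 : 0 <= eta ^+ 3 * (Lv^-1 * chi ^+ 2 * sv ^+ 2) by nneg.
rewrite /cA /cB /cC; lra.
Qed.

End RoundAlgebra.

(** * Decrease of F in one round, pathwise and averaged over the sampled set *)

Section Round.
Context {R : realType} {n d0 : nat} {d : 'I_n -> nat}.
Context (F : forall i : 'I_n, 'rV[R]_d0 -> 'rV[R]_(d i) -> R).
Arguments F : clear implicits.
Hypothesis hFdiff : forall (i : 'I_n) (p : 'rV[R]_d0 * 'rV[R]_(d i)),
  differentiable (fun q : 'rV[R]_d0 * 'rV[R]_(d i) => F i q.1 q.2) p.
Context (m : nat) (Lu Lv Luv Lvu chi : R).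
Hypothesis m0 : (0 < m)%N.
Hypothesis mn : (m <= n)%N.
Hypothesis Lu0 : 0 < Lu.
Hypothesis Lv0 : 0 < Lv.
Hypothesis chi0 : 0 < chi.
Hypothesis hA1uu : forall (i : 'I_n) (v : 'rV[R]_(d i)) (u u' : 'rV[R]_d0),
  enorm (gradu (F i) u v - gradu (F i) u' v) <= Lu * enorm (u - u').
Hypothesis hA1uv : forall (i : 'I_n) (u : 'rV[R]_d0) (v v' : 'rV[R]_(d i)),
  enorm (gradu (F i) u v - gradu (F i) u v') <= Luv * enorm (v - v').
Hypothesis hchiL : Num.max Luv Lvu <= chi * Num.sqrt (Lu * Lv).

Implicit Types (u : 'rV[R]_d0) (v : forall i : 'I_n, 'rV[R]_(d i)).

Let n0 : (0 < n)%N. Proof. exact: leq_trans m0 mn. Qed.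
Let nR : 0 < n%:R :> R. Proof. by rewrite ltr0n. Qed.
Let mR : 0 < m%:R :> R. Proof. by rewrite ltr0n. Qed.
Let nne : n%:R != 0 :> R. Proof. by rewrite gt_eqF. Qed.
Let mne : m%:R != 0 :> R. Proof. by rewrite gt_eqF. Qed.
Let mnR : m%:R <= n%:R :> R. Proof. by rewrite ler_nat. Qed.

Definition avg (f : 'I_n -> R) : R := n%:R^-1 * \sum_(i < n) f i.

Lemma avgD f g : avg (fun i => f i + g i) = avg f + avg g.
Proof. by rewrite /avg big_split mulrDr. Qed.

Lemma avgZ a f : avg (fun i => a * f i) = a * avg f.
Proof. by rewrite /avg -mulr_sumr mulrCA. Qed.

Lemma avgN f : avg (fun i => - f i) = - avg f.
Proof. by rewrite /avg sumrN mulrN. Qed.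

Lemma avg_cst a : avg (fun=> a) = a.
Proof.
by rewrite /avg sumr_const card_ord -[a *+ n]mulr_natl mulrA mulVf// mul1r.
Qed.

Lemma avg_le f g : (forall i, f i <= g i) -> avg f <= avg g.
Proof.
move=> h; rewrite /avg; apply: ler_wpM2l; first by rewrite invr_ge0 ltW.
exact: ler_sum.
Qed.

Lemma avg_ge0 f : (forall i, 0 <= f i) -> 0 <= avg f.
Proof. by move=> h; rewrite -(avg_cst 0); exact: avg_le. Qed.

Lemma sqnorm_gradu_uv i u (a b : 'rV[R]_(d i)) :
  sqnorm (gradu (F i) u a - gradu (F i) u b) <= chi ^+ 2 * (Lu * Lv) * sqnorm (a - b).
Proof.
have -> : chi ^+ 2 * (Lu * Lv) = (chi * Num.sqrt (Lu * Lv)) ^+ 2.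
  by rewrite exprMn sqr_sqrtr// mulr_ge0// ltW.
apply: enorm_le_sqnorm (hA1uv _ _ _).
  by apply: le_trans hchiL; rewrite le_max lexx.
by rewrite mulr_ge0 ?sqrtr_ge0// ltW.
Qed.

Lemma sqnorm_gradu_uu i u u' (a : 'rV[R]_(d i)) :
  sqnorm (gradu (F i) u a - gradu (F i) u' a) <= Lu ^+ 2 * sqnorm (u - u').
Proof. by apply: enorm_le_sqnorm (hA1uu _ _ _); rewrite // ltW. Qed.

Lemma gradFu_lipschitz u u' v :
  enorm (gradFu F u v - gradFu F u' v) <= Lu * enorm (u - u').
Proof.
apply: sqnorm_le_enorm; first exact: ltW.
rewrite !gradFuE// -scalerBr -sumrB sqnormZ.
apply: (@le_trans _ _ (n%:R^-1 ^+ 2 * (n%:R * \sum_(i < n) Lu ^+ 2 * sqnorm (u - u')))).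
  apply: ler_wpM2l; first exact: sqr_ge0.
  apply: le_trans (sqnorm_ord_sum_le _) _; apply: ler_wpM2l => //.
  by apply: ler_sum => i _; exact: sqnorm_gradu_uu.
rewrite sumr_const card_ord -[_ *+ n]mulr_natl le_eqVlt; apply/orP; left.
by apply/eqP; field; rewrite nne.
Qed.

(** Only the devices of A contribute, and Cauchy-Schwarz over them leaves #|A| / n^2. For the
    unsampled devices this gives one factor 1 - m/n; averaging over S gives another. *)
Lemma sqnorm_gradFu_diff u v v' (A : {pred 'I_n}) :
  (forall i, i \notin A -> v i = v' i) ->
  sqnorm (gradFu F u v - gradFu F u v') <=
  chi ^+ 2 * (Lu * Lv) * (#|A|%:R / n%:R ^+ 2) * \sum_(i in A) sqnorm (v i - v' i).
Proof.
move=> hA; rewrite !gradFuE// -scalerBr -sumrB sqnormZ.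
have -> : \sum_(i < n) (gradu (F i) u (v i) - gradu (F i) u (v' i)) =
    \sum_(i in A) (gradu (F i) u (v i) - gradu (F i) u (v' i)).
  rewrite [LHS](bigID (mem A)) /= [X in _ + X]big1 ?addr0// => i /hA ->.
  by rewrite subrr.
apply: (@le_trans _ _ (n%:R^-1 ^+ 2 * (#|A|%:R *
    \sum_(i in A) chi ^+ 2 * (Lu * Lv) * sqnorm (v i - v' i)))).
  apply: ler_wpM2l; first exact: sqr_ge0.
  apply: le_trans (sqnorm_sum_le _ _) _; apply: ler_wpM2l => //.
  by apply: ler_sum => i _; exact: sqnorm_gradu_uv.
by rewrite -mulr_sumr exprVn le_eqVlt; apply/orP; left; apply/eqP; ring.
Qed.

(** Converts the gradient at the virtual parameters, which the descent controls, into the one the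
    theorem measures. *)
Lemma sqnorm_gradFu_le u v v' :
  sqnorm (gradFu F u v) <= 2 * sqnorm (gradFu F u v') +
    2 * (chi ^+ 2 * (Lu * Lv)) * avg (fun i => sqnorm (v' i - v i)).
Proof.
rewrite -[gradFu F u v](subrK (gradFu F u v')) addrC.
apply: le_trans (sqnormD_le _ _) _; rewrite mulrDr lerD2l -mulrA ler_pM2l//.
apply: le_trans (@sqnorm_gradFu_diff u v v' predT _) _ => //.
rewrite card_ord /avg le_eqVlt; apply/orP; left; apply/eqP.
have -> : \sum_(i < n) sqnorm (v i - v' i) = \sum_(i < n) sqnorm (v' i - v i).
  by apply: eq_bigr => i _; rewrite -sqnormN opprB.
by field; rewrite nne.
Qed.

Lemma card_unsampled (S : {set 'I_n}) : #|S| = m -> #|~: S|%:R = n%:R - m%:R :> R.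
Proof.
move=> cS; have := cardsC S; rewrite cS card_ord => nE.
by rewrite -natrB// -[in RHS]nE addKn.
Qed.

Lemma sample_mean_dev k (S : {set 'I_n}) (h : 'I_n -> 'rV[R]_k) : #|S| = m ->
  sqnorm (m%:R^-1 *: \sum_(i in S) h i) <= m%:R^-1 * \sum_(i in S) sqnorm (h i).
Proof.
move=> cS; rewrite sqnormZ.
apply: le_trans (ler_wpM2l (sqr_ge0 _) (sqnorm_sum_le _ _)) _.
by rewrite cS le_eqVlt; apply/orP; left; apply/eqP; field; rewrite mne.
Qed.

(* If the h_i sum to 0, the sum over S is minus the sum over the complement,
   which is what produces the factor 1 - m/n without computing a variance. *)
Lemma sample_mean_dev_compl k (S : {set 'I_n}) (h : 'I_n -> 'rV[R]_k) : #|S| = m ->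
  \sum_(i < n) h i = 0 ->
  sqnorm (m%:R^-1 *: \sum_(i in S) h i) <=
  (n%:R - m%:R) / m%:R ^+ 2 * \sum_(i | i \notin S) sqnorm (h i).
Proof.
move=> cS h0; have -> : \sum_(i in S) h i = - \sum_(i in ~: S) h i.
  apply/eqP; rewrite -addr_eq0; apply/eqP; rewrite -[RHS]h0 [RHS](bigID (mem S)) /=.
  by congr (_ + _); apply: eq_bigl => i; rewrite !inE.
rewrite scalerN sqnormN sqnormZ.
apply: le_trans (ler_wpM2l (sqr_ge0 _) (sqnorm_sum_le _ _)) _.
rewrite card_unsampled// exprVn mulrA [_^-1 * _]mulrC.
by under eq_bigl do rewrite inE.
Qed.

(* The first bound on the deviation of the sample mean is used when 2m <= n,
   the second one otherwise; either way the mean is at most 2(1 - m/n). *)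
Definition dev_in : R := if (2 * m <= n)%N then m%:R^-1 else 0.
Definition dev_out : R := if (2 * m <= n)%N then 0 else (n%:R - m%:R) / m%:R ^+ 2.

(** If 2m <= n, the left side is 1 and 1 - m/n is at least 1/2. Otherwise it is (n - m)^2 / m^2, and
    n - m <= m together with n <= 2m gives (n - m) n <= 2 m^2. *)
Lemma dev_le : m%:R * dev_in + (n%:R - m%:R) * dev_out <= 2 * (1 - m%:R / n%:R).
Proof.
rewrite /dev_in /dev_out; case: ifP => [h|/negbT].
  rewrite mulfV// mulr0 addr0.
  have h2 : m%:R / n%:R <= 2^-1 :> R.
    rewrite ler_pdivrMr// mulrC ler_pdivlMr//.
    by rewrite -natrM ler_nat mulnC.
  lra.
rewrite -ltnNge => h; rewrite mulr0 add0r mulrCA.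
have h2 : n%:R <= 2 * m%:R :> R by rewrite -natrM ler_nat ltnW.
have -> : 2 * (1 - m%:R / n%:R) = (n%:R - m%:R) * (2 / n%:R) :> R.
  by field; rewrite nne.
have nm0 : 0 <= n%:R - m%:R :> R by rewrite subr_ge0.
rewrite mulrA -mulrA; apply: ler_wpM2l => //.
rewrite ler_pdivrMr ?exprn_gt0// mulrAC ler_pdivlMr// expr2.
have h3 : n%:R - m%:R <= m%:R :> R by lra.
have := ler_pM nm0 (ltW nR) h3 h2.
by lra.
Qed.

Context (eta : R).

Section Step.
Context (u : 'rV[R]_d0) (v vt : forall i : 'I_n, 'rV[R]_(d i)).
Context (y : 'I_n -> 'rV[R]_d0).
Let g i := gradu (F i) u (vt i).
Let gb := gradFu F u vt.

(* Contribution of device i to the decrease if it is sampled; [round_out i] is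
   its contribution otherwise. *)
Definition round_in i : R :=
  n%:R^-1 * (F i u (vt i) - F i u (v i)) +
  m%:R^-1 * (dot gb (y i - u) +
    3 * Lu * (sqnorm (y i - u + (eta / Lu) *: g i) + (eta / Lu) ^+ 2 * sqnorm gb)) +
  3 * Lu * (eta / Lu) ^+ 2 * dev_in * sqnorm (g i - gb).

Definition round_out i : R :=
  chi ^+ 2 * Lv / 2 * ((n%:R - m%:R) / n%:R ^+ 2) * sqnorm (vt i - v i) +
  3 * Lu * (eta / Lu) ^+ 2 * dev_out * sqnorm (g i - gb).

Let sum_dev : \sum_(i < n) (g i - gb) = 0.
Proof.
rewrite sumrB sumr_const card_ord /gb gradFuE// -/(g _) -scaler_nat scalerA.
by rewrite mulfV// scale1r subrr.
Qed.

(** Smoothness in u costs Lu/2 times the squared server move, and Young's inequality, used to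
    replace the gradient at v' by [gb], costs the same again. Splitting that move into three pieces
    turns the sum Lu into the coefficient 3 Lu. *)
Lemma round_step (S : {set 'I_n}) : #|S| = m ->
  Favg F (m%:R^-1 *: \sum_(i in S) y i) (fun i => if i \in S then vt i else v i)
    - Favg F u v <=
  \sum_(i < n) ((i \in S)%:R * round_in i + (i \notin S)%:R * round_out i).
Proof.
move=> cS; set u' := _ *: _; set v' := fun i => _.
have -> : \sum_(i < n) ((i \in S)%:R * round_in i + (i \notin S)%:R * round_out i)
   = \sum_(i in S) round_in i + \sum_(i | i \notin S) round_out i.
  rewrite big_split /=; congr (_ + _); rewrite [RHS]big_mkcond /=;
    by apply: eq_bigr => i _; case: (i \in S); rewrite /= ?mul1r ?mul0r.
have mean_cst k (c : 'rV[R]_k) : m%:R^-1 *: \sum_(i in S) c = c.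
  by rewrite sumr_const cS -[c *+ m]scaler_nat scalerA mulVf// scale1r.
have eu : u' - u = m%:R^-1 *: \sum_(i in S) (y i - u).
  by rewrite sumrB scalerBr mean_cst.
have e1 : Favg F u v' - Favg F u v =
    n%:R^-1 * \sum_(i in S) (F i u (vt i) - F i u (v i)).
  rewrite /Favg -mulrBr -sumrB [in RHS]big_mkcond /=; congr (_ * _).
  by apply: eq_bigr => i _; rewrite /v'; case: ifP => // _; rewrite subrr.
have h1 : Favg F u' v' <= Favg F u v' + dot (gradFu F u v') (u' - u) +
    Lu / 2 * sqnorm (u' - u).
  apply: (descent (f := fun u => Favg F u v')); first exact: ltW.
    by move=> z; exact: differentiable_Favg.
  by move=> z z'; exact: gradFu_lipschitz.
have h2 : dot (gradFu F u v') (u' - u) <= dot gb (u' - u) +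
   (Lu^-1 / 2) * sqnorm (gradFu F u v' - gb) + Lu / 2 * sqnorm (u' - u).
  rewrite -{1}[gradFu F u v'](subrK gb) addrC dotDl -addrA lerD2l.
  have iLu : 0 < Lu^-1 by rewrite invr_gt0.
  by have := dot_young (gradFu F u v' - gb) (u' - u) iLu; rewrite invrK; lra.
have h3 : (Lu^-1 / 2) * sqnorm (gradFu F u v' - gb) <=
    chi ^+ 2 * Lv / 2 * ((n%:R - m%:R) / n%:R ^+ 2) *
    \sum_(i | i \notin S) sqnorm (vt i - v i).
  have c0 : 0 <= Lu^-1 / 2 by rewrite divr_ge0// invr_ge0 ltW.
  apply: le_trans (ler_wpM2l c0 (@sqnorm_gradFu_diff u v' vt (~: S) _)) _.
    by move=> i; rewrite inE negbK /v' => ->.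
  rewrite card_unsampled//.
  have -> : \sum_(i in ~: S) sqnorm (v' i - vt i) =
      \sum_(i | i \notin S) sqnorm (vt i - v i).
    apply: eq_big => [i|i]; first by rewrite inE.
    by rewrite inE /v' => /negbTE ->; rewrite -sqnormN opprB.
  by rewrite le_eqVlt; apply/orP; left; apply/eqP; field; rewrite nne gt_eqF.
have h4 : dot gb (u' - u) = m%:R^-1 * \sum_(i in S) dot gb (y i - u).
  by rewrite eu dotZr dot_sumr.
set c := eta / Lu.
(* The server move is the mean residual, plus the ideal step along - [gb], plus the error of the
   sampled mean of the g_i. *)
have h5 : sqnorm (u' - u) <= 3 * (m%:R^-1 * \sum_(i in S) sqnorm (y i - u + c *: g i) +
   c ^+ 2 * sqnorm gb + c ^+ 2 * sqnorm (m%:R^-1 *: \sum_(i in S) (g i - gb))).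
  have -> : u' - u = m%:R^-1 *: (\sum_(i in S) (y i - u + c *: g i)) + (- c) *: gb +
      (- c) *: (m%:R^-1 *: \sum_(i in S) (g i - gb)).
    rewrite eu [\sum_(i in S) (y i - u +
      c *: g i)]big_split /= -scaler_sumr [\sum_(i in S) (g i - gb)]sumrB.
    rewrite [m%:R^-1 *: (_ + c *: _)]scalerDr scalerBr mean_cst.
    rewrite [m%:R^-1 *: (c *: _)]scalerA [_^-1 * c]mulrC -scalerA.
    rewrite [- c *: (_ - gb)]scalerBr !scaleNr opprK.
    by rewrite -!addrA (addrCA (- (c *: gb))) addNr addr0 subrr addr0.
  apply: le_trans (sqnormD3_le _ _ _) _; rewrite !(sqnormZ (- c)) sqrrN.
  by rewrite ler_pM2l// !lerD2r; exact: sample_mean_dev.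
have h6 : sqnorm (m%:R^-1 *: \sum_(i in S) (g i - gb)) <=
    dev_in * \sum_(i in S) sqnorm (g i - gb) +
    dev_out * \sum_(i | i \notin S) sqnorm (g i - gb).
  rewrite /dev_in /dev_out; case: ifP => _; rewrite mul0r ?addr0 ?add0r.
    exact: sample_mean_dev.
  exact: sample_mean_dev_compl.
have -> : \sum_(i in S) round_in i =
   n%:R^-1 * \sum_(i in S) (F i u (vt i) - F i u (v i)) +
   (m%:R^-1 * \sum_(i in S) dot gb (y i - u) + 3 * Lu * (m%:R^-1 *
     \sum_(i in S) sqnorm (y i - u + c *: g i) + c ^+ 2 * sqnorm gb)) +
   3 * Lu * c ^+ 2 * dev_in * \sum_(i in S) sqnorm (g i - gb).
  rewrite /round_in 2!big_split /= -!mulr_sumr; congr (_ + _ + _).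
  rewrite big_split /= -mulr_sumr big_split /= sumr_const cS -[_ *+ m]mulr_natl.
  by rewrite -/c; field; rewrite mne.
have -> : \sum_(i | i \notin S) round_out i =
    chi ^+ 2 * Lv / 2 * ((n%:R - m%:R) / n%:R ^+ 2) *
      \sum_(i | i \notin S) sqnorm (vt i - v i) +
    3 * Lu * c ^+ 2 * dev_out * \sum_(i | i \notin S) sqnorm (g i - gb).
  by rewrite /round_out big_split /= -!mulr_sumr.
have h7 := ler_wpM2l (ltW Lu0) h5.
have c20 : 0 <= 3 * Lu * c ^+ 2 by rewrite mulr_ge0 ?sqr_ge0// mulr_ge0// ltW.
have h8 := ler_wpM2l c20 h6.
rewrite -e1 -h4.
lra.
Qed.

Let p : R := m%:R / n%:R.

(** Since p / m = 1 / n, weighting by p and 1 - p turns the sums over sampled and unsampled devices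
    into plain means, to which [round_algebra] applies. *)
Lemma round_mean (rho del kv ku : R) (nv nu Iv Iu : 'I_n -> R) :
  0 < eta -> eta * (24 * (1 + rho ^+ 2)) <= 1 ->
  128 * chi ^+ 2 * (1 - p) * eta <= p -> chi ^+ 2 * eta ^+ 2 <= p ->
  0 <= kv -> kv <= 1 -> 0 <= ku -> ku <= 1 ->
  (forall i, 0 <= nv i) -> (forall i, 0 <= nu i) ->
  avg (fun i => sqnorm (g i - gb)) <= del ^+ 2 + rho ^+ 2 * sqnorm gb ->
  (forall i, F i u (vt i) - F i u (v i) <=
     eta / Lv * (- sqnorm (gradv (F i) u (v i)) / 2 +
       2 * eta ^+ 2 * kv * (sqnorm (gradv (F i) u (v i)) + nv i) +
       2 * eta * (sqnorm (gradv (F i) u (v i)) + nv i)) - Iv i) ->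
  (forall i, sqnorm (vt i - v i) <=
     4 * (eta ^+ 2 / Lv ^+ 2) * (sqnorm (gradv (F i) u (v i)) + nv i)) ->
  (forall i, dot gb (y i - u) <= eta / Lu * (- dot gb (g i) + sqnorm gb / 2 +
     2 * eta ^+ 2 * ku * (sqnorm (g i) + nu i)) - Iu i) ->
  (forall i, sqnorm (y i - u + (eta / Lu) *: g i) <=
     eta ^+ 2 / Lu ^+ 2 * (8 * eta ^+ 2 * ku * (sqnorm (g i) + nu i) + 2 * nu i)) ->
  \sum_(i < n) (p * round_in i + (1 - p) * round_out i) <=
  - (eta / 80) * (sqnorm (gradFu F u v) / Lu +
      p / Lv * avg (fun i => sqnorm (gradv (F i) u (v i))))
  + cA eta p Lu del ku + cB eta p chi Lv kv * avg nv + cC eta Lu ku * avg nu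
  - p * avg Iv - avg Iu.
Proof.
move=> eta0 e1 e2 e3 kv0 kv1 ku0 ku1 nv0 nu0 hH hFV hQV hDU hRE.
pose H := avg (fun i => sqnorm (g i - gb)).
pose FV := avg (fun i => F i u (vt i) - F i u (v i)).
pose DU := avg (fun i => dot gb (y i - u)).
pose RE := avg (fun i => sqnorm (y i - u + (eta / Lu) *: g i)).
pose QV := avg (fun i => sqnorm (vt i - v i)).
pose Gv := avg (fun i => sqnorm (gradv (F i) u (v i))).
pose c := 3 * Lu * (eta / Lu) ^+ 2 * (m%:R * dev_in + (n%:R - m%:R) * dev_out).
have -> : \sum_(i < n) (p * round_in i + (1 - p) * round_out i) =
    p * FV + DU + 3 * Lu * (RE + (eta / Lu) ^+ 2 * sqnorm gb) + c * H
    + chi ^+ 2 * Lv / 2 * (1 - p) ^+ 2 * QV.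
  rewrite -(avg_cst ((eta / Lu) ^+ 2 * sqnorm gb)) -avgD -!avgZ -!avgD.
  rewrite /avg mulr_sumr; apply: eq_bigr => i _.
  rewrite /round_in /round_out /c /p.
  by field; rewrite nne mne gt_eqF.
(* Exact because [gb] is the mean of the g_i. *)
have avg_g : avg (fun i => dot gb (g i)) = sqnorm gb.
  rewrite /avg -dot_sumr -dotZr sqnormE; congr (dot gb _).
  by rewrite /gb gradFuE.
(* Mean of squares = square of the mean + variance; the cross term vanishes by [sum_dev]. *)
have GU : avg (fun i => sqnorm (g i)) = sqnorm gb + H.
  have E i : sqnorm (g i) = (sqnorm (g i - gb) + 2 * dot gb (g i - gb)) + sqnorm gb.
    by rewrite -[in LHS](subrK gb (g i)) (sqnormD (g i - gb) gb) (dotC (g i - gb)).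
  rewrite (_ : (fun i => _) = (fun i => (sqnorm (g i - gb) + 2 * dot gb (g i - gb))
    + sqnorm gb)); last by apply/funext.
  rewrite !avgD avg_cst avgZ [X in 2 * X]/avg -dot_sumr sum_dev dot0r.
  by rewrite !mulr0 addr0 addrC.
have p0 : 0 <= p by rewrite divr_ge0 ?ler0n.
have p1 : p <= 1 by rewrite ler_pdivrMr// mul1r.
apply: round_algebra hH _ _ _ _ _ _ => //.
- exact: sqnorm_ge0.
- by apply: avg_ge0 => i; exact: sqnorm_ge0.
- by apply: avg_ge0 => i; exact: sqnorm_ge0.
- exact: avg_ge0.
- exact: avg_ge0.
- apply: le_trans (avg_le hFV) _.
  pose al := 2 * eta ^+ 2 * kv + 2 * eta.
  rewrite (_ : (fun i => _) = (fun i => eta / Lv * (al - 2^-1) *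
    sqnorm (gradv (F i) u (v i)) + eta / Lv * al * nv i - Iv i)); last first.
    by apply/funext => i; rewrite /al; field; rewrite gt_eqF.
  rewrite 2!avgD avgN !avgZ -/Gv /al le_eqVlt; apply/orP; left; apply/eqP.
  by field; rewrite gt_eqF.
- apply: le_trans (avg_le hDU) _.
  rewrite (_ : (fun i => _) = (fun i => - (eta / Lu) * dot gb (g i) +
    eta / Lu * (2 * eta ^+ 2 * ku) * sqnorm (g i) + eta / Lu * (2 * eta ^+ 2 * ku) * nu i
    + eta / Lu * (sqnorm gb / 2) - Iu i)); last first.
    by apply/funext => i; field; rewrite gt_eqF.
  rewrite 4!avgD avgN avg_cst !avgZ avg_g GU -/H le_eqVlt; apply/orP; left; apply/eqP.
  by field; rewrite gt_eqF.
- by apply: le_trans (avg_le hRE) _; rewrite avgZ avgD !avgZ avgD GU.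
- by apply: le_trans (avg_le hQV) _; rewrite avgZ avgD.
- exact: sqnorm_gradFu_le.
- rewrite /c; have c0 : 0 <= 3 * Lu * (eta / Lu) ^+ 2 by nneg.
  apply: le_trans (ler_wpM2l c0 dev_le) _.
  rewrite le_eqVlt; apply/orP; left; apply/eqP; rewrite /p.
  by field; rewrite nne gt_eqF.
Qed.

End Step.
End Round.

(** * Measurability and integrability of iterates *)

Section MoreMeasurability.
Context {R : realType} {dT : measure_display} {T : measurableType dT}.

Lemma vmeasurable_sum k (I : Type) (s : seq I) (Q : pred I) (X : I -> T -> 'rV[R]_k) :
  (forall i, vmeasurable (X i)) -> vmeasurable (fun w => \sum_(i <- s | Q i) X i w).
Proof.
move=> h j; under eq_fun do rewrite summxE.
elim: s => [|i s IH].
  by under eq_fun do rewrite big_nil; exact: measurable_cst.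
have [Qi|nQi] := boolP (Q i).
  by under eq_fun do rewrite big_cons Qi; apply: measurable_funD => //; exact: h.
by under eq_fun do rewrite big_cons (negbTE nQi).
Qed.

Lemma vmeasurable_if k (c : T -> bool) (X Y : T -> 'rV[R]_k) :
  measurable_fun setT c -> vmeasurable X -> vmeasurable Y ->
  vmeasurable (fun w => if c w then X w else Y w).
Proof.
move=> mc mX mY j.
rewrite (_ : (fun w => _) = (fun w => if c w then X w 0 j else Y w 0 j)).
  by apply: measurable_fun_ifT; [|exact: mX|exact: mY].
by apply/funext => w; case: (c w).
Qed.

Lemma measurable_dot k (X Y : T -> 'rV[R]_k) : vmeasurable X -> vmeasurable Y ->
  measurable_fun setT (fun w => dot (X w) (Y w)).
Proof.
by move=> mX mY; apply: measurable_sum => j; apply: measurable_funM; [exact: mX|exact: mY].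
Qed.

(** Only steps j < K are required to be measurable: the K-th iterate must belong to a past that
    excludes the K-th sample. *)
Lemma lsgd_vmeasurable k (G : T -> 'rV[R]_k -> nat -> 'rV[R]_k) gam (x0 : T -> 'rV[R]_k) K :
  vmeasurable x0 ->
  (forall X j, (j < K)%N -> vmeasurable X -> vmeasurable (fun w => G w (X w) j)) ->
  vmeasurable (fun w => lsgd (G w) gam (x0 w) K).
Proof.
move=> mx; elim: K => [//|K IH] hG /=.
apply: vmeasurableB.
  by apply: IH => X j jK; apply: hG; rewrite ltnS ltnW.
by apply/vmeasurableZ/hG => //; apply: IH => X j jK; apply: hG; rewrite ltnS ltnW.
Qed.

Context (P : probability T R).

Lemma vL2_if k (c : T -> bool) (X Y : T -> 'rV[R]_k) :
  measurable_fun setT c -> vL2 P X -> vL2 P Y ->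
  vL2 P (fun w => if c w then X w else Y w).
Proof.
move=> mc hX hY; apply: (vL2_le (f := fun w => sqnorm (X w) + sqnorm (Y w))).
- by apply: vmeasurable_if => //; exact: vL2_measurable.
- by move=> w; case: (c w); rewrite ?lerDl ?lerDr sqnorm_ge0.
- by apply: L1D; exact: L1_sqnorm.
Qed.

Lemma L1_abs (f : T -> R) : L1 P f -> L1 P (fun w => `|f w|).
Proof. by move=> hf; exact: (integrable_abse hf). Qed.

Lemma L1_between (f lo hi : T -> R) : measurable_fun setT f ->
  (forall w, lo w <= f w) -> (forall w, f w <= hi w) -> L1 P lo -> L1 P hi -> L1 P f.
Proof.
move=> mf hlo hhi ilo ihi.
apply: (L1_le mf (g := fun w => `|lo w| + `|hi w|)).
  move=> w; have := hlo w; have := hhi w; have := ler_norm (hi w).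
  have := ler_norm (- lo w); rewrite normrN ler_norml => h1 h2 h3 h4.
  have := normr_ge0 (lo w); have := normr_ge0 (hi w) => h5 h6.
  by apply/andP; split; lra.
by apply: L1D; exact: L1_abs.
Qed.

(** Linear growth, by going from (X, Y) through (X, 0) to (0, 0). *)
Lemma vL2_lipschitz a b k (g : 'rV[R]_a -> 'rV[R]_b -> 'rV[R]_k) (A B : R)
    (X : T -> 'rV[R]_a) (Y : T -> 'rV[R]_b) :
  continuous (fun q : 'rV[R]_a * 'rV[R]_b => g q.1 q.2) ->
  (forall u u' v, sqnorm (g u v - g u' v) <= A * sqnorm (u - u')) ->
  (forall u v v', sqnorm (g u v - g u v') <= B * sqnorm (v - v')) ->
  vL2 P X -> vL2 P Y -> vL2 P (fun w => g (X w) (Y w)).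
Proof.
move=> cg gA gB hX hY.
apply: (vL2_le (f := fun w => 3 * (B * sqnorm (Y w) + A * sqnorm (X w) + sqnorm (g 0 0)))).
- by apply: vmeasurable_continuous => //; exact: vL2_measurable.
- move=> w; rewrite -[X in sqnorm X](subrK (g (X w) 0)) -[X in _ + X](subrK (g 0 0)) addrA.
  apply: le_trans (sqnormD3_le _ _ _) _; rewrite ler_pM2l// lerD2r.
  apply: lerD; first by have := gB (X w) (Y w) 0; rewrite subr0.
  by have := gA (X w) 0 0; rewrite subr0.
- apply: L1Z; apply: L1D; last exact: L1_cst.
  by apply: L1D; apply: L1Z; exact: L1_sqnorm.
Qed.

End MoreMeasurability.

(** * Expectations and telescoping *)

Unset Implicit Arguments.

Section FedAlt.
Context {R : realType} (n m : nat).
Hypothesis m0 : (0 < m)%N.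
Hypothesis mn : (m <= n)%N.
Context {d0 : nat} {d : 'I_n -> nat}.
Context (F : forall i : 'I_n, 'rV[R]_d0 -> 'rV[R]_(d i) -> R).
Hypothesis hFdiff : forall (i : 'I_n) (p : 'rV[R]_d0 * 'rV[R]_(d i)),
  differentiable (fun q : 'rV[R]_d0 * 'rV[R]_(d i) => F i q.1 q.2) p.
Hypothesis hFC1u : forall i : 'I_n,
  continuous (fun q : 'rV[R]_d0 * 'rV[R]_(d i) => gradu (F i) q.1 q.2).
Hypothesis hFC1v : forall i : 'I_n,
  continuous (fun q : 'rV[R]_d0 * 'rV[R]_(d i) => gradv (F i) q.1 q.2).
Context (dZ : measure_display) (Z : measurableType dZ) (D : 'I_n -> probability Z R).
Context (Gu : forall i : 'I_n, 'rV[R]_d0 -> 'rV[R]_(d i) -> Z -> 'rV[R]_d0).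
Context (Gv : forall i : 'I_n, 'rV[R]_d0 -> 'rV[R]_(d i) -> Z -> 'rV[R]_(d i)).
Hypothesis hGu_meas : forall (i : 'I_n) (j : 'I_d0),
  jointly_measurable (fun p : 'rV[R]_d0 * 'rV[R]_(d i) * Z =>
                        Gu i p.1.1 p.1.2 p.2 0 j).
Hypothesis hGv_meas : forall (i : 'I_n) (j : 'I_(d i)),
  jointly_measurable (fun p : 'rV[R]_d0 * 'rV[R]_(d i) * Z =>
                        Gv i p.1.1 p.1.2 p.2 0 j).
Context (Lu Lv Luv Lvu chi : R).
Hypothesis Lu0 : 0 < Lu.
Hypothesis Lv0 : 0 < Lv.
Hypothesis chi0 : 0 < chi.
Hypothesis hA1uu : forall (i : 'I_n) (v : 'rV[R]_(d i)) (u u' : 'rV[R]_d0),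
  enorm (gradu (F i) u v - gradu (F i) u' v) <= Lu * enorm (u - u').
Hypothesis hA1vv : forall (i : 'I_n) (u : 'rV[R]_d0) (v v' : 'rV[R]_(d i)),
  enorm (gradv (F i) u v - gradv (F i) u v') <= Lv * enorm (v - v').
Hypothesis hA1uv : forall (i : 'I_n) (u : 'rV[R]_d0) (v v' : 'rV[R]_(d i)),
  enorm (gradu (F i) u v - gradu (F i) u v') <= Luv * enorm (v - v').
Hypothesis hA1vu : forall (i : 'I_n) (v : 'rV[R]_(d i)) (u u' : 'rV[R]_d0),
  enorm (gradv (F i) u v - gradv (F i) u' v) <= Lvu * enorm (u - u').
Hypothesis hchiL : Num.max Luv Lvu <= chi * Num.sqrt (Lu * Lv).
Context (sigu sigv : R).
Hypothesis hA2u_mean : forall (i : 'I_n) u v (j : 'I_d0),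
  (D i).-integrable setT (fun z => (Gu i u v z 0 j)%:E) /\
  (\int[D i]_z (Gu i u v z 0 j)%:E = (gradu (F i) u v 0 j)%:E)%E.
Hypothesis hA2v_mean : forall (i : 'I_n) u v (j : 'I_(d i)),
  (D i).-integrable setT (fun z => (Gv i u v z 0 j)%:E) /\
  (\int[D i]_z (Gv i u v z 0 j)%:E = (gradv (F i) u v 0 j)%:E)%E.
Hypothesis hA2u_var : forall (i : 'I_n) u v,
  (\int[D i]_z (sqnorm (Gu i u v z - gradu (F i) u v))%:E <= (sigu ^+ 2)%:E)%E.
Hypothesis hA2v_var : forall (i : 'I_n) u v,
  (\int[D i]_z (sqnorm (Gv i u v z - gradv (F i) u v))%:E <= (sigv ^+ 2)%:E)%E.
Context (tau_u tau_v : nat) (gam_u gam_v : R).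
Context (u0 : 'rV[R]_d0) (V0 : forall i : 'I_n, 'rV[R]_(d i)).
Context (dO : measure_display) (Omega : measurableType dO) (P : probability Omega R).
Context (S : nat -> Omega -> {set 'I_n}) (zv zu : nat -> 'I_n -> nat -> Omega -> Z).
Hypothesis hS_meas : forall t (A : {set 'I_n}), measurable [set w | S t w = A].
Hypothesis hS_unif : forall t (A : {set 'I_n}),
  P [set w | S t w = A] = (if #|A| == m then ('C(n, m)%:R)^-1 else 0)%:E.
Hypothesis hzv_meas : forall t i k, measurable_fun setT (zv t i k).
Hypothesis hzu_meas : forall t i k, measurable_fun setT (zu t i k).
Hypothesis hzv_law : forall t i k (B : set Z), measurable B ->
  P (zv t i k @^-1` B) = D i B.
Hypothesis hzu_law : forall t i k (B : set Z), measurable B ->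
  P (zu t i k @^-1` B) = D i B.
Hypothesis hindep : mutually_independent P (fedalt_events S zv zu).

Let ev := fedalt_events S zv zu.

Let evI j : setI_closed (ev j).
Proof.
case: j => [t|[[[t i] k]|[[t i] k]]] A A' /=.
- by move=> [B ->] [B' ->]; exists (B `&` B').
- by move=> [B [mB ->]] [B' [mB' ->]]; exists (B `&` B'); split=> //; exact: measurableI.
- by move=> [B [mB ->]] [B' [mB' ->]]; exists (B `&` B'); split=> //; exact: measurableI.
Qed.

Let evT j : ev j setT.
Proof. by case: j => [t|[[[t i] k]|[[t i] k]]] /=; exists setT. Qed.

Let S_preimage_measurable t (B : set {set 'I_n}) : measurable (S t @^-1` B).
Proof.
rewrite (_ : _ @^-1` _ = \bigcup_(A in B) [set w | S t w = A]).
  by apply: fin_bigcup_measurable; [exact: finite_finset|move=> A _; exact: hS_meas].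
by apply/seteqP; split=> [w Bw|w [A BA /= ->//]]; exists (S t w).
Qed.

Let evm j A : ev j A -> measurable A.
Proof.
case: j => [t|[[[t i] k]|[[t i] k]]] /= [B].
- by move=> ->; exact: S_preimage_measurable.
- by move=> [mB ->]; rewrite -[X in measurable X]setTI; exact: hzv_meas.
- by move=> [mB ->]; rewrite -[X in measurable X]setTI; exact: hzu_meas.
Qed.

Definition round_of (j : fedalt_index n) : nat :=
  match j with
  | inl t => t
  | inr (inl (t, _, _)) => t
  | inr (inr (t, _, _)) => t
  end.

Let before t : set (fedalt_index n) := [set j | (round_of j < t)%N].
Let vidx (t : nat) (i : 'I_n) (k : nat) : fedalt_index n := inr (inl (t, i, k)).
Let uidx (t : nat) (i : 'I_n) (k : nat) : fedalt_index n := inr (inr (t, i, k)).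
Let sidx (t : nat) : fedalt_index n := inl t.

Let zv_past (J : set (fedalt_index n)) (t : nat) (i : 'I_n) (k : nat) :
  J (vidx t i k) -> measurable_fun setT (zv t i k : past ev J -> Z).
Proof.
move=> Jj _ B mB; rewrite setTI; apply: (past_generator (E := ev) Jj).
by rewrite /ev /=; exists B.
Qed.

Let zu_past (J : set (fedalt_index n)) (t : nat) (i : 'I_n) (k : nat) :
  J (uidx t i k) -> measurable_fun setT (zu t i k : past ev J -> Z).
Proof.
move=> Jj _ B mB; rewrite setTI; apply: (past_generator (E := ev) Jj).
by rewrite /ev /=; exists B.
Qed.

Let S_past (J : set (fedalt_index n)) (t : nat) (i : 'I_n) :
  J (sidx t) -> measurable_fun setT (fun w : past ev J => i \in S t w).
Proof.
move=> Jj _ B _; rewrite setTI; apply: (past_generator (E := ev) Jj).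
by rewrite /ev /=; exists [set A : {set 'I_n} | B (i \in A)].
Qed.

(** * The FedAlt process with its virtual runs *)

Let st t w := fedalt_state m Gu Gv gam_u gam_v tau_u tau_v
  (fun t' => S t' w) (fun t' i k => zv t' i k w) (fun t' i k => zu t' i k w) u0 V0 t.
Let u t w := (st t w).1.
Let v t i w := (st t w).2 i.
Let xv t i k w := lsgd (fun x k => Gv i (u t w) x (zv t i k w)) gam_v (v t i w) k.
Let vt t i w := xv t i tau_v w.
Let xu t i k w := lsgd (fun x k => Gu i x (vt t i w) (zu t i k w)) gam_u (u t w) k.
Let yu t i w := xu t i tau_u w.
Let xiv t i k w := Gv i (u t w) (xv t i k w) (zv t i k w) - gradv (F i) (u t w) (xv t i k w).
Let xiu t i k w := Gu i (xu t i k w) (vt t i w) (zu t i k w) - gradu (F i) (xu t i k w) (vt t i w).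

(** For i in S the v-update actually performed is the virtual one, so the server mean can be written
    with runs that are defined for every device. *)
Let uS t w : u t.+1 w = m%:R^-1 *: \sum_(i in S t w) yu t i w.
Proof.
congr (_ *: _); apply: eq_bigr => i iS; rewrite /yu /xu /vt /xv.
by rewrite [if _ then _ else _]ifT.
Qed.

Let xv_past (J : set (fedalt_index n)) (t : nat) (i : 'I_n) (k : nat) :
  vmeasurable (u t : past ev J -> _) ->
  vmeasurable (v t i : past ev J -> _) ->
  (forall k', (k' < k)%N -> J (vidx t i k')) -> vmeasurable (xv t i k : past ev J -> _).
Proof.
move=> mu mv hJ; apply: lsgd_vmeasurable => // X j jk mX l.
apply: (jointly_measurable_comp (hGv_meas i l)) => //.
by apply: zv_past; exact: hJ.
Qed.

Let xu_past (J : set (fedalt_index n)) (t : nat) (i : 'I_n) (k : nat) :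
  vmeasurable (u t : past ev J -> _) ->
  vmeasurable (v t i : past ev J -> _) ->
  (forall k', J (vidx t i k')) -> (forall k', (k' < k)%N -> J (uidx t i k')) ->
  vmeasurable (xu t i k : past ev J -> _).
Proof.
move=> mu mv hJ hJ'; apply: lsgd_vmeasurable => // X j jk mX l.
apply: (jointly_measurable_comp (hGu_meas i l)) => //.
  by apply: xv_past.
by apply: zu_past; exact: hJ'.
Qed.

(** J is arbitrary above [before t] because each fresh sample brings its own past. *)
Let state_past (J : set (fedalt_index n)) (t : nat) : before t `<=` J ->
  vmeasurable (u t : past ev J -> _) /\
  forall i, vmeasurable (v t i : past ev J -> _).
Proof.
elim: t => [|t IH] hJ.
  by split=> [j|i j]; exact: measurable_cst.
have [|mu mv] := IH; first by move=> j jt; apply: hJ; rewrite /before /= ltnS ltnW.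
have hv i k : J (vidx t i k) by apply: hJ; rewrite /before /= ltnS.
have hu i k : J (uidx t i k) by apply: hJ; rewrite /before /= ltnS.
have hS : J (sidx t) by apply: hJ; rewrite /before /= ltnS.
split=> [|i].
  (* A sum over a random set becomes a sum over all devices with measurable selectors. *)
  rewrite (_ : u t.+1 = fun w => m%:R^-1 *: \sum_i (if i \in S t w then yu t i w else 0)).
    apply/vmeasurableZ/vmeasurable_sum => i; apply: vmeasurable_if.
    - exact: S_past.
    - exact: xu_past.
    - by move=> j; exact: measurable_cst.
  by apply/funext => w; rewrite uS big_mkcond.
rewrite (_ : v t.+1 i = fun w => if i \in S t w then vt t i w else v t i w)//.
by apply: vmeasurable_if; [exact: S_past|exact: xv_past|].
Qed.

(** The largest family avoiding j0, later rounds included. Freshness only asks that j0 be absent, so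
    this one past serves every quantity that does not use j0. *)
Let except (j0 : fedalt_index n) : set (fedalt_index n) := [set j | j <> j0].

Let not_except j0 : ~ except j0 j0. Proof. exact. Qed.

Let before_except t j0 : (t <= round_of j0)%N -> before t `<=` except j0.
Proof. by move=> tj j /= + e; rewrite /before /= e ltnNge tj. Qed.

Let sqnorm_gradv_vv i (a : 'rV[R]_d0) (b b' : 'rV[R]_(d i)) :
  sqnorm (gradv (F i) a b - gradv (F i) a b') <= Lv ^+ 2 * sqnorm (b - b').
Proof. by apply: enorm_le_sqnorm (hA1vv _ _ _ _); rewrite // ltW. Qed.

Let sqnorm_gradv_vu i (a a' : 'rV[R]_d0) (b : 'rV[R]_(d i)) :
  sqnorm (gradv (F i) a b - gradv (F i) a' b) <=
  (chi * Num.sqrt (Lu * Lv)) ^+ 2 * sqnorm (a - a').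
Proof.
apply: enorm_le_sqnorm (hA1vu _ _ _ _).
  by apply: le_trans hchiL; rewrite le_max lexx orbT.
by rewrite mulr_ge0 ?sqrtr_ge0// ltW.
Qed.

Let vL2_gradv i (X : Omega -> 'rV[R]_d0) (Y : Omega -> 'rV[R]_(d i)) :
  vL2 P X -> vL2 P Y -> vL2 P (fun w => gradv (F i) (X w) (Y w)).
Proof.
exact: (vL2_lipschitz (hFC1v i) (sqnorm_gradv_vu i) (sqnorm_gradv_vv i)).
Qed.

Let vL2_gradu i (X : Omega -> 'rV[R]_d0) (Y : Omega -> 'rV[R]_(d i)) :
  vL2 P X -> vL2 P Y -> vL2 P (fun w => gradu (F i) (X w) (Y w)).
Proof.
apply: (vL2_lipschitz (hFC1u i) (A := Lu ^+ 2) (B := chi ^+ 2 * (Lu * Lv))).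
  by move=> a a' b; exact: (sqnorm_gradu_uu Lu0 hA1uu).
by move=> a b b'; exact: (sqnorm_gradu_uv Lu0 Lv0 chi0 hA1uv hchiL).
Qed.

Let xiv_noise t i k : vL2 P (xiv t i k) /\
  expect P (fun w => sqnorm (xiv t i k w)) <= sigv ^+ 2 /\
  forall W : Omega -> 'rV[R]_(d i),
    (forall J, before t `<=` J -> vmeasurable (W : past ev J -> _)) ->
    vL2 P W -> expect P (fun w => dot (W w) (xiv t i k w)) = 0.
Proof.
pose j := vidx t i k.
have bj : before t `<=` except j by apply: before_except.
have [mu mv] := state_past _ _ bj.
(* The k-th iterate uses only the samples k' < k of its run, hence not the sample j. *)
have mx : vmeasurable (xv t i k : past ev (except j) -> _).
  apply: xv_past => // k' k'k; rewrite /except /= /j /vidx => -[kk].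
  by rewrite kk ltnn in k'k.
have zE B : measurable B -> ev j (zv t i k @^-1` B) by move=> mB; rewrite /ev /=; exists B.
split.
  exact: (noise_vL2 evI evT evm hindep (not_except j) (hzv_meas t i k) zE (hzv_law t i k)
    (hGv_meas i) (hFC1v i) (hA2v_var i) mu mx).
split.
  exact: (noise_variance evI evT evm hindep (not_except j) (hzv_meas t i k) zE (hzv_law t i k)
    (hGv_meas i) (hFC1v i) (hA2v_var i) mu mx).
move=> W mW hW.
exact: (noise_mean evI evT evm hindep (not_except j) (hzv_meas t i k) zE (hzv_law t i k)
    (hGv_meas i) (hFC1v i) (hA2v_mean i) (hA2v_var i) mu mx (mW _ bj) hW).
Qed.

(** The test vector may depend on all v-phase samples of the current round, as [gb] does; none of
    them is the u-phase sample in question. *)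
Let xiu_noise t i k : vL2 P (xiu t i k) /\
  expect P (fun w => sqnorm (xiu t i k w)) <= sigu ^+ 2 /\
  forall W : Omega -> 'rV[R]_d0,
    (forall J, before t `<=` J -> (forall i k, J (vidx t i k)) ->
       vmeasurable (W : past ev J -> _)) ->
    vL2 P W -> expect P (fun w => dot (W w) (xiu t i k w)) = 0.
Proof.
pose j := uidx t i k.
have bj : before t `<=` except j by apply: before_except.
have [mu mv] := state_past _ _ bj.
have mx : vmeasurable (xu t i k : past ev (except j) -> _).
  apply: xu_past => // k' k'k; rewrite /except /= /j /uidx => -[kk].
  by rewrite kk ltnn in k'k.
have mvt : vmeasurable (vt t i : past ev (except j) -> _) by apply: xv_past.
have zE B : measurable B -> ev j (zu t i k @^-1` B) by move=> mB; rewrite /ev /=; exists B.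
split.
  exact: (noise_vL2 evI evT evm hindep (not_except j) (hzu_meas t i k) zE (hzu_law t i k)
    (hGu_meas i) (hFC1u i) (hA2u_var i) mx mvt).
split.
  exact: (noise_variance evI evT evm hindep (not_except j) (hzu_meas t i k) zE (hzu_law t i k)
    (hGu_meas i) (hFC1u i) (hA2u_var i) mx mvt).
move=> W mW hW.
apply: (noise_mean evI evT evm hindep (not_except j) (hzu_meas t i k) zE (hzu_law t i k)
    (hGu_meas i) (hFC1u i) (hA2u_mean i) (hA2u_var i) mx mvt _ hW).
by apply: mW.
Qed.

(** The stochastic gradient is split into noise, square-integrable by its variance bound, and the
    true gradient, which has linear growth. *)
Let xv_L2 t i k : vL2 P (u t) -> vL2 P (v t i) -> vL2 P (xv t i k).
Proof.
move=> hu hv; elim: k => [//|k IH].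
apply: (vL2_ext (X := fun w => xv t i k w -
    gam_v *: (xiv t i k w + gradv (F i) (u t w) (xv t i k w)))).
  by move=> w; rewrite subrK.
apply: vL2B => //; apply: vL2Z; apply: vL2D; first by case: (xiv_noise t i k).
exact: vL2_gradv.
Qed.

Let xu_L2 t i k : vL2 P (u t) -> vL2 P (v t i) -> vL2 P (xu t i k).
Proof.
move=> hu hv; have hvt : vL2 P (vt t i) by exact: xv_L2.
elim: k => [//|k IH].
apply: (vL2_ext (X := fun w => xu t i k w -
    gam_u *: (xiu t i k w + gradu (F i) (xu t i k w) (vt t i w)))).
  by move=> w; rewrite subrK.
apply: vL2B => //; apply: vL2Z; apply: vL2D; first by case: (xiu_noise t i k).
exact: vL2_gradu.
Qed.

Let mS t i : measurable_fun setT (fun w => i \in S t w).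
Proof.
by move=> _ B _; rewrite setTI; exact: (S_preimage_measurable t [set A : {set 'I_n} | B (i \in A)]).
Qed.

Let state_L2 t : vL2 P (u t) /\ forall i, vL2 P (v t i).
Proof.
elim: t => [|t [hu hv]].
  by split=> [|i]; exact: vL2_cst.
split=> [|i].
  apply: (vL2_ext (X := fun w => m%:R^-1 *: \sum_i (if i \in S t w then yu t i w else 0))).
    by move=> w; rewrite uS [in RHS]big_mkcond.
  apply/vL2Z/vL2_sum => i; apply: vL2_if; [exact: mS|exact: xu_L2|exact: vL2_cst].
by apply: vL2_if; [exact: mS|exact: xv_L2|exact: hv].
Qed.

Let u_L2 t : vL2 P (u t). Proof. by case: (state_L2 t). Qed.
Let v_L2 t i : vL2 P (v t i). Proof. by case: (state_L2 t). Qed.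
Let vt_L2 t i : vL2 P (vt t i). Proof. by apply: xv_L2. Qed.
Let yu_L2 t i : vL2 P (yu t i). Proof. by apply: xu_L2. Qed.

Let measurable_F i dT (T : measurableType dT) (X : T -> 'rV[R]_d0) (Y : T -> 'rV[R]_(d i)) :
  vmeasurable X -> vmeasurable Y -> measurable_fun setT (fun w => F i (X w) (Y w)).
Proof.
move=> mX mY; apply: (measurable_continuous2 (f := fun q => F i q.1 q.2)) => //.
by move=> q; apply: differentiable_continuous; exact: hFdiff.
Qed.

Let descent_v i a (b b' : 'rV[R]_(d i)) :
  F i a b' <= F i a b + dot (gradv (F i) a b) (b' - b) + Lv / 2 * sqnorm (b' - b).
Proof.
apply: (descent (f := F i a)); first exact: ltW.
  by move=> z; exact: differentiable_sectionr.
by move=> z z'; exact: hA1vv.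
Qed.

Let descent_u i a a' (b : 'rV[R]_(d i)) :
  F i a' b <= F i a b + dot (gradu (F i) a b) (a' - a) + Lu / 2 * sqnorm (a' - a).
Proof.
apply: (descent (f := fun a => F i a b)); first exact: ltW.
  by move=> z; exact: differentiable_sectionl.
by move=> z z'; exact: hA1uu.
Qed.

(** The descent inequality, used from either endpoint, traps F between integrable bounds: first
    along u with personal parameter 0, then along v. *)
Let L1_F i (X : Omega -> 'rV[R]_d0) (Y : Omega -> 'rV[R]_(d i)) :
  vL2 P X -> vL2 P Y -> L1 P (fun w => F i (X w) (Y w)).
Proof.
move=> hX hY.
have c0 k : vL2 P (fun=> 0 : 'rV[R]_k) by exact: vL2_cst.
have h0X : vL2 P (fun w => 0 - X w) by exact: vL2B.
have hX0 : vL2 P (fun w => X w - 0) by exact: vL2B.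
have h0Y : vL2 P (fun w => 0 - Y w) by exact: vL2B.
have hY0 : vL2 P (fun w => Y w - 0) by exact: vL2B.
have hXF : L1 P (fun w => F i (X w) 0).
  apply: (L1_between
    (lo := fun w => F i 0 0 - dot (gradu (F i) (X w) 0) (0 - X w) - Lu / 2 * sqnorm (0 - X w))
    (hi := fun w => F i 0 0 + dot (gradu (F i) 0 0) (X w - 0) + Lu / 2 * sqnorm (X w - 0))).
  - by apply: measurable_F; apply: vL2_measurable.
  - by move=> w; have := descent_u i (X w) 0 0; lra.
  - by move=> w; exact: descent_u.
  - apply: L1B; last exact/L1Z/L1_sqnorm.
    by apply: L1B; [exact: L1_cst|apply: L1_dot => //; exact: vL2_gradu].
  - apply: L1D; last exact/L1Z/L1_sqnorm.
    by apply: L1D; [exact: L1_cst|apply: L1_dot => //; exact: vL2_cst].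
apply: (L1_between
  (lo := fun w => F i (X w) 0 - dot (gradv (F i) (X w) (Y w)) (0 - Y w)
     - Lv / 2 * sqnorm (0 - Y w))
  (hi := fun w => F i (X w) 0 + dot (gradv (F i) (X w) 0) (Y w - 0)
     + Lv / 2 * sqnorm (Y w - 0))).
- by apply: measurable_F; apply: vL2_measurable.
- by move=> w; have := descent_v i (X w) (Y w) 0; lra.
- by move=> w; exact: descent_v.
- apply: L1B; last exact/L1Z/L1_sqnorm.
  by apply: L1B => //; apply: L1_dot => //; exact: vL2_gradv.
- apply: L1D; last exact/L1Z/L1_sqnorm.
  by apply: L1D => //; apply: L1_dot => //; exact: vL2_gradv.
Qed.

(** * Law of the sampled set *)

Let prob_S t (Q : {set 'I_n} -> bool) :
  fine (P [set w | Q (S t w)]) =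
  #|[set A : {set 'I_n} | Q A & #|A| == m]%SET|%:R / 'C(n, m)%:R.
Proof.
have mQ : measurable [set w | Q (S t w)] := S_preimage_measurable t [set A | Q A].
have prE A : measurable A -> fine (P A) = expect P (\1_A).
  by move=> mA; rewrite /expect /Rintegral integral_indic// setIT.
have L1i A : measurable A -> L1 P (\1_A : Omega -> R).
  by move=> mA; exact: integrable_indic.
rewrite prE//.
transitivity (expect P (fun w => \sum_(A | Q A) \1_[set w | S t w = A] w)).
  apply: expect_ext => w; rewrite indicE.
  have [Qw|nQw] := boolP (Q (S t w)).
    rewrite mem_set// (bigD1 (S t w))//= indicE mem_set// big1 ?addr0// => A /andP[_ nA].
    by rewrite indicE memNset// => /= e; rewrite e eqxx in nA.
  rewrite memNset; last exact/negP.
  rewrite big1// => A QA; rewrite indicE memNset// => /= e.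
  by rewrite e QA in nQw.
rewrite expect_sum => [|A]; last exact: L1i.
rewrite (eq_bigr (fun A : {set 'I_n} => if #|A| == m then ('C(n, m)%:R)^-1 else 0)).
  rewrite -big_mkcondr /= sumr_const -[LHS]mulr_natl; congr (_%:R / _).
  by apply: eq_card => A; rewrite !inE.
by move=> A _; rewrite -prE// (congr1 fine (hS_unif t A)).
Qed.

Let bin_gt0R : 0 < 'C(n, m)%:R :> R. Proof. by rewrite ltr0n bin_gt0. Qed.

Let prob_card t : P [set w | #|S t w| == m] = 1%E.
Proof.
have mc : measurable [set w | #|S t w| == m] :=
  S_preimage_measurable t [set A : {set 'I_n} | #|A| == m].
rewrite -[LHS]fineK ?fin_num_measure//.
rewrite (prob_S t (fun A => #|A| == m)); congr EFin.
rewrite (_ : [set A | _ & _]%SET = [set A : {set 'I_n} | #|A| == m]%SET).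
  by rewrite card_draws card_ord divff// gt_eqF.
by apply/setP => A; rewrite !inE andbb.
Qed.

Let prob_out t i : fine (P ((fun w => i \notin S t w) @^-1` [set true])) = 1 - m%:R / n%:R.
Proof.
have n0 : (0 < n)%N := leq_trans m0 mn.
rewrite (_ : _ @^-1` _ = [set w | i \notin S t w])//.
rewrite (prob_S t (fun A => i \notin A)).
rewrite (_ : [set A | _ & _]%SET =
    [set A : {set 'I_n} | A \subset (~: [set i])%SET & #|A| == m]%SET); last first.
  apply/setP => A; rewrite !inE; congr (_ && _).
  by rewrite finset.subsetC finset.sub1set inE.
rewrite cards_draws cardsC1 card_ord.
(* The sets avoiding i are the m-subsets of the n - 1 other devices; this identity gives their
   proportion. *)
have h : n%:R * 'C(n.-1, m)%:R = (n%:R - m%:R) * 'C(n, m)%:R :> R.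
  by rewrite -natrB// -!natrM mul_bin_down.
have nne : n%:R != 0 :> R by rewrite pnatr_eq0 -lt0n.
have -> : 'C(n.-1, m)%:R = (n%:R - m%:R) * 'C(n, m)%:R / n%:R :> R.
  by rewrite -h mulrAC divff// mul1r.
by field; rewrite nne gt_eqF.
Qed.

Let prob_in t i : fine (P ((fun w => i \in S t w) @^-1` [set true])) = m%:R / n%:R.
Proof.
have := prob_out t i.
rewrite (_ : _ @^-1` _ = ~` ((fun w => i \in S t w) @^-1` [set true])).
  have mi : measurable ((fun w => i \in S t w) @^-1` [set true]).
    by rewrite -[X in measurable X]setTI; exact: mS.
  rewrite (congr1 fine (probability_setC P mi)) fineB ?fin_num_measure//= => h; lra.
by apply/seteqP; split=> w /=; case: (i \in S t w).
Qed.

(** * Descent in expectation *)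

Context (delta rho eta : R).
Hypothesis hA3 : forall u (V : forall i : 'I_n, 'rV[R]_(d i)),
  n%:R^-1 * \sum_(i < n) sqnorm (gradu (F i) u (V i) - gradFu F u V)
    <= delta ^+ 2 + rho ^+ 2 * sqnorm (gradFu F u V).
Hypothesis htu : (0 < tau_u)%N.
Hypothesis htv : (0 < tau_v)%N.
Hypothesis eta0 : 0 < eta.
Hypothesis gam_uE : gam_u = eta / (Lu * tau_u%:R).
Hypothesis gam_vE : gam_v = eta / (Lv * tau_v%:R).
Let p : R := m%:R / n%:R.
Let ku : R := 1 - tau_u%:R^-1.
Let kv : R := 1 - tau_v%:R^-1.
Hypothesis eta1 : eta * (24 * (1 + rho ^+ 2)) <= 1.
Hypothesis eta2 : 128 * chi ^+ 2 * (1 - p) * eta <= p.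
Hypothesis eta3 : chi ^+ 2 * eta ^+ 2 <= p.

Let eta24 : eta <= 24^-1.
Proof. by move: eta1 (mulr_ge0 (ltW eta0) (sqr_ge0 rho)) => h1 h2; lra. Qed.

Let gam_u0 : 0 <= gam_u.
Proof. by rewrite gam_uE divr_ge0 ?mulr_ge0 ?ler0n// ltW. Qed.

Let gam_v0 : 0 <= gam_v.
Proof. by rewrite gam_vE divr_ge0 ?mulr_ge0 ?ler0n// ltW. Qed.

Let gv t i w := gradv (F i) (u t w) (v t i w).
Let gu t i w := gradu (F i) (u t w) (vt t i w).
Let gb t w := gradFu F (u t w) (fun i => vt t i w).
Let nv t i w := (\sum_(k < tau_v) sqnorm (xiv t i k w)) / tau_v%:R.
Let nu t i w := (\sum_(k < tau_u) sqnorm (xiu t i k w)) / tau_u%:R.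
Let Iv t i w := gam_v * \sum_(k < tau_v) dot (gv t i w) (xiv t i k w).
Let Iu t i w := gam_u * \sum_(k < tau_u) dot (gb t w) (xiu t i k w).
Let Fs t w := Favg F (u t w) (fun i => v t i w).
Let rin t i w := round_in F m Lu eta (u t w) (fun i => v t i w) (fun i => vt t i w)
  (fun i => yu t i w) i.
Let rout t i w := round_out F m Lu Lv chi eta (u t w) (fun i => v t i w)
  (fun i => vt t i w) i.

Let gv_L2 t i : vL2 P (gv t i). Proof. exact: vL2_gradv. Qed.
Let gu_L2 t i : vL2 P (gu t i). Proof. exact: vL2_gradu. Qed.

Let gbE t : gb t = fun w => n%:R^-1 *: \sum_(i < n) gu t i w.
Proof. by apply/funext => w; rewrite /gb gradFuE. Qed.

Let gb_L2 t : vL2 P (gb t).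
Proof. by rewrite gbE; apply/vL2Z/vL2_sum => i. Qed.

Let gradFu_L2 t : vL2 P (fun w => gradFu F (u t w) (fun i => v t i w)).
Proof.
apply: (vL2_ext (X := fun w => n%:R^-1 *: \sum_(i < n) gradu (F i) (u t w) (v t i w))).
  by move=> w; rewrite gradFuE.
by apply/vL2Z/vL2_sum => i; exact: vL2_gradu.
Qed.

Let Fs_L1 t : L1 P (Fs t).
Proof. by apply/L1Z/L1_sum => i; exact: L1_F. Qed.

Let rin_L1 t i : L1 P (rin t i).
Proof.
have hy : vL2 P (fun w => yu t i w - u t w) by exact: vL2B.
apply: L1D; last exact: (L1Z _ (L1_sqnorm (vL2B (gu_L2 t i) (gb_L2 t)))).
apply: L1D; first by apply/L1Z/L1B; exact: L1_F.
apply/L1Z/L1D; first exact: (L1_dot (gb_L2 t) hy).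
apply/L1Z/L1D; last exact: (L1Z _ (L1_sqnorm (gb_L2 t))).
exact: (L1_sqnorm (vL2D hy (vL2Z _ (gu_L2 t i)))).
Qed.

Let rout_L1 t i : L1 P (rout t i).
Proof.
apply: L1D; last exact: (L1Z _ (L1_sqnorm (vL2B (gu_L2 t i) (gb_L2 t)))).
exact: (L1Z _ (L1_sqnorm (vL2B (vt_L2 t i) (v_L2 t i)))).
Qed.

Let gb_past (J : set (fedalt_index n)) t : vmeasurable (u t : past ev J -> _) ->
  (forall i, vmeasurable (vt t i : past ev J -> _)) -> vmeasurable (gb t : past ev J -> _).
Proof.
move=> mu mvt; rewrite gbE; apply/vmeasurableZ/vmeasurable_sum => i.
exact: (vmeasurable_continuous (hFC1u i)).
Qed.

(** The past contains everything but the sampled set of round t, including the current samples of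
    all devices. The virtual runs live there, so the contributions are independent of S t. *)
Let rin_past t i (J := except (sidx t)) :
  measurable_fun setT (rin t i : past ev J -> R) /\
  measurable_fun setT (rout t i : past ev J -> R).
Proof.
have bj : before t `<=` J by apply: before_except.
have [mu mv] := state_past _ _ bj.
have mvt k : vmeasurable (vt t k : past ev J -> _) by apply: xv_past.
have my : vmeasurable (yu t i : past ev J -> _) by apply: xu_past.
have mgb := gb_past _ _ mu mvt.
have mgu : vmeasurable (gu t i : past ev J -> _).
  exact: (vmeasurable_continuous (hFC1u i)).
have myu : vmeasurable (fun w : past ev J => yu t i w - u t w) by exact: vmeasurableB.
have mdev : measurable_fun setT (fun w : past ev J => sqnorm (gu t i w - gb t w)).
  by apply: vmeasurable_sqnorm; exact: vmeasurableB.
split; last first.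
  apply: measurable_funD; apply: measurable_funM => //.
  by apply: vmeasurable_sqnorm; exact: vmeasurableB.
apply: measurable_funD; last exact: measurable_funM.
apply: measurable_funD; apply: measurable_funM => //.
  by apply: measurable_funB; exact: measurable_F.
apply: measurable_funD; first exact: measurable_dot.
apply: measurable_funM => //; apply: measurable_funD.
  by apply: vmeasurable_sqnorm; apply: vmeasurableD => //; exact: vmeasurableZ.
by apply: measurable_funM => //; exact: vmeasurable_sqnorm.
Qed.

Let EU t := expect P (fun w => sqnorm (gradFu F (u t w) (fun i => v t i w))).
Let EV t := expect P (fun w => avg (fun i => sqnorm (gv t i w))).

Let round_le t : expect P (fun w => Fs t.+1 w - Fs t w) <=
  expect P (fun w => \sum_(i < n) (p * rin t i w + (1 - p) * rout t i w)).
Proof.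
have sE (c : Omega -> bool) i : (forall w, c w = (i \in S t w)) \/ (forall w, c w = (i \notin S t w)) ->
  forall B, ev (sidx t) (c @^-1` B).
  move=> [h|h] B; rewrite /ev /=.
    by exists [set A : {set 'I_n} | B (i \in A)]; apply/seteqP; split=> w /=; rewrite h.
  by exists [set A : {set 'I_n} | B (i \notin A)]; apply/seteqP; split=> w /=; rewrite h.
have hin i := expect_indep evI evT evm hindep (not_except (sidx t))
  (sE (fun w => i \in S t w) i (or_introl (fun=> erefl))) (rin_past t i).1 (rin_L1 t i).
have hout i := expect_indep evI evT evm hindep (not_except (sidx t))
  (sE (fun w => i \notin S t w) i (or_intror (fun=> erefl))) (rin_past t i).2 (rout_L1 t i).
have hL i : L1 P (fun w => (i \in S t w)%:R * rin t i w + (i \notin S t w)%:R * rout t i w).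
  by apply: L1D; [case: (hin i)|case: (hout i)].
apply: (@le_trans _ _ (expect P (fun w => \sum_(i < n)
   ((i \in S t w)%:R * rin t i w + (i \notin S t w)%:R * rout t i w)))).
  (* The pathwise bound is only claimed when S has m elements, an event of probability one. *)
  apply: (expect_le_ae _ (prob_card t)).
  - exact: (S_preimage_measurable t [set A : {set 'I_n} | #|A| == m]).
  - exact: L1B.
  - exact: L1_sum.
  - move=> w /= /eqP cS; rewrite /Fs uS.
    exact: (round_step hFdiff m0 mn Lu0 Lv0 chi0 hA1uu hA1uv hchiL).
rewrite !expect_sum// => [|i]; last by apply: L1D; exact: L1Z.
apply: ler_sum => i _.
rewrite !expectD; [|exact: L1Z|exact: L1Z|by case: (hin i)|by case: (hout i)].
by rewrite (hin i).2 (hout i).2 prob_in prob_out !expectZ.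
Qed.

Let kappa_bounds k : (0 < k)%N -> 0 <= 1 - k%:R^-1 :> R /\ 1 - k%:R^-1 <= 1 :> R.
Proof.
move=> k0; have kR : 1 <= k%:R :> R by rewrite ler1n.
split; first by rewrite subr_ge0 invf_le1// (lt_le_trans ltr01).
by rewrite gerBl invr_ge0.
Qed.

(** In the v-phase [lsgd_inner] is tested against the run's own first gradient, which yields -
    |gv|^2 / 2, and smoothness in v adds the quadratic term bounded by [lsgd_dist]. In the u-phase
    the test vector is [gb]. *)
Let round_pointwise t w :
  \sum_(i < n) (p * rin t i w + (1 - p) * rout t i w) <=
  - (eta / 80) * (sqnorm (gradFu F (u t w) (fun i => v t i w)) / Lu +
      p / Lv * avg (fun i => sqnorm (gv t i w)))
  + cA eta p Lu delta ku + cB eta p chi Lv kv * avg (fun i => nv t i w)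
  + cC eta Lu ku * avg (fun i => nu t i w)
  - p * avg (fun i => Iv t i w) - avg (fun i => Iu t i w).
Proof.
have [kv0 kv1] := kappa_bounds _ htv; have [ku0 ku1] := kappa_bounds _ htu.
have gLv i : forall x y, sqnorm (gradv (F i) (u t w) x - gradv (F i) (u t w) y) <=
    Lv ^+ 2 * sqnorm (x - y) by move=> x y; exact: sqnorm_gradv_vv.
have gLu i : forall x y, sqnorm (gradu (F i) x (vt t i w) - gradu (F i) y (vt t i w)) <=
    Lu ^+ 2 * sqnorm (x - y) by move=> x y; exact: (sqnorm_gradu_uu Lu0 hA1uu).
have hdist i : sqnorm (vt t i w - v t i w) <=
    4 * (eta ^+ 2 / Lv ^+ 2) * (sqnorm (gv t i w) + nv t i w).
  exact: (lsgd_dist (fun x k => Gv i (u t w) x (zv t i k w)) (v t i w)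
    gam_v0 Lv0 (gLv i) htv eta24 gam_vE).
apply: (round_mean hFdiff m0 mn Lu0 Lv0 chi0 hA1uv hchiL (rho := rho)) => //.
- by move=> i; rewrite divr_ge0// sumr_ge0// => k _; exact: sqnorm_ge0.
- by move=> i; rewrite divr_ge0// sumr_ge0// => k _; exact: sqnorm_ge0.
- exact: (hA3 (u t w) (fun i => vt t i w)).
- move=> i; have h1 := descent_v i (u t w) (v t i w) (vt t i w).
  have h2 := lsgd_inner (fun x k => Gv i (u t w) x (zv t i k w)) (v t i w)
    gam_v0 Lv0 (gLv i) htv eta0 eta24 gam_vE (gv t i w).
  rewrite -/(gv t i w) in h1; rewrite -/(gv t i w) -!sqnormE in h2.
  have L20 : 0 <= Lv / 2 by rewrite divr_ge0// ltW.
  have h3 := ler_wpM2l L20 (hdist i).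
  have e3 : Lv / 2 * (4 * (eta ^+ 2 / Lv ^+ 2) * (sqnorm (gv t i w) + nv t i w)) =
     eta / Lv * (2 * eta * (sqnorm (gv t i w) + nv t i w)) by field; rewrite gt_eqF.
  rewrite e3 in h3.
  have h4 : dot (gv t i w) (vt t i w - v t i w) <= eta / Lv *
    (- sqnorm (gv t i w) + sqnorm (gv t i w) / 2 +
     2 * eta ^+ 2 * kv * (sqnorm (gv t i w) + nv t i w)) - Iv t i w by exact: h2.
  by rewrite -/(gv t i w); lra.
- move=> i.
  exact: (lsgd_inner (fun x k => Gu i x (vt t i w) (zu t i k w)) (u t w)
    gam_u0 Lu0 (gLu i) htu eta0 eta24 gam_uE (gb t w)).
- move=> i.
  exact: (lsgd_residual (fun x k => Gu i x (vt t i w) (zu t i k w)) (u t w)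
    gam_u0 Lu0 (gLu i) htu eta0 eta24 gam_uE).
Qed.

Let expect_avg (f : 'I_n -> Omega -> R) : (forall i, L1 P (f i)) ->
  L1 P (fun w => avg (fun i => f i w)) /\
  expect P (fun w => avg (fun i => f i w)) = avg (fun i => expect P (f i)).
Proof.
move=> h; split; first exact/L1Z/L1_sum.
by rewrite expectZ ?expect_sum//; exact: L1_sum.
Qed.

Let gv_past (J : set (fedalt_index n)) t i : before t `<=` J ->
  vmeasurable (gv t i : past ev J -> _).
Proof.
by move=> /state_past [mu mv]; exact: (vmeasurable_continuous (hFC1v i)).
Qed.

Let noise_sum (k : nat) (dim : nat) (x : nat -> Omega -> 'rV[R]_dim) (s : R) : (0 < k)%N ->
  (forall j, vL2 P (x j)) -> (forall j, expect P (fun w => sqnorm (x j w)) <= s ^+ 2) ->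
  L1 P (fun w => (\sum_(j < k) sqnorm (x j w)) / k%:R) /\
  expect P (fun w => (\sum_(j < k) sqnorm (x j w)) / k%:R) <= s ^+ 2.
Proof.
move=> k0 hx hs; have kR : 0 < k%:R :> R by rewrite ltr0n.
have -> : (fun w => (\sum_(j < k) sqnorm (x j w)) / k%:R) =
    (fun w => k%:R^-1 * \sum_(j < k) sqnorm (x j w)).
  by apply/funext => w; rewrite mulrC.
have hL : L1 P (fun w => \sum_(j < k) sqnorm (x j w)).
  by apply: L1_sum => j; exact: L1_sqnorm.
split; first exact: L1Z.
rewrite expectZ// expect_sum => [|j]; last exact: L1_sqnorm.
rewrite ler_pdivrMl//; apply: le_trans (ler_sum _ (fun (j : 'I_k) _ => hs j)) _.
by rewrite sumr_const card_ord mulr_natl.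
Qed.

Let nv_E t i : L1 P (nv t i) /\ expect P (nv t i) <= sigv ^+ 2.
Proof.
apply: (noise_sum _ _ (xiv t i)) => // k; first by case: (xiv_noise t i k).
by case: (xiv_noise t i k) => _ [].
Qed.

Let nu_E t i : L1 P (nu t i) /\ expect P (nu t i) <= sigu ^+ 2.
Proof.
apply: (noise_sum _ _ (xiu t i)) => // k; first by case: (xiu_noise t i k).
by case: (xiu_noise t i k) => _ [].
Qed.

Let Iv_E t i : L1 P (Iv t i) /\ expect P (Iv t i) = 0.
Proof.
have h k : L1 P (fun w => dot (gv t i w) (xiv t i k w)).
  by apply: L1_dot => //; case: (xiv_noise t i k).
split; first exact/L1Z/L1_sum.
rewrite expectZ; last exact: L1_sum.
rewrite expect_sum// big1 ?mulr0// => k _.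
case: (xiv_noise t i k) => _ [_]; apply=> [J hJ|]; [exact: gv_past|exact: gv_L2].
Qed.

Let Iu_E t i : L1 P (Iu t i) /\ expect P (Iu t i) = 0.
Proof.
have h k : L1 P (fun w => dot (gb t w) (xiu t i k w)).
  by apply: L1_dot => //; case: (xiu_noise t i k).
split; first exact/L1Z/L1_sum.
rewrite expectZ; last exact: L1_sum.
rewrite expect_sum// big1 ?mulr0// => k _.
case: (xiu_noise t i k) => _ [_]; apply=> [J hJ hJ'|]; last exact: gb_L2.
have [mu mv] := state_past _ _ hJ.
by apply: gb_past => // i'; apply: xv_past.
Qed.

Let p0 : 0 <= p. Proof. by rewrite divr_ge0 ?ler0n. Qed.

Let p1 : p <= 1.
Proof.
by rewrite ler_pdivrMr ?mul1r ?ler_nat// ltr0n (leq_trans m0).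
Qed.

Let budget : R := cA eta p Lu delta ku + cB eta p chi Lv kv * sigv ^+ 2
  + cC eta Lu ku * sigu ^+ 2.

Let EU_L1 t : L1 P (fun w => sqnorm (gradFu F (u t w) (fun i => v t i w))).
Proof. by apply: L1_sqnorm. Qed.

Let EV_L1 t : L1 P (fun w => avg (fun i => sqnorm (gv t i w))).
Proof. by apply: (expect_avg _ _).1 => i; exact: L1_sqnorm. Qed.

Let round_descent t : expect P (Fs t.+1) - expect P (Fs t) <=
  - (eta / 80) * (EU t / Lu + p / Lv * EV t) + budget.
Proof.
have [kv0 _] := kappa_bounds _ htv; have [ku0 _] := kappa_bounds _ htu.
have pc0 : 0 <= 1 - p by rewrite subr_ge0.
have eta00 := ltW eta0; have Lu00 := ltW Lu0; have Lv00 := ltW Lv0.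
have cB0 : 0 <= cB eta p chi Lv kv by rewrite /cB; nneg.
have cC0 : 0 <= cC eta Lu ku by rewrite /cC; nneg.
have [hnv nvE] := expect_avg _ (fun i => (nv_E t i).1).
have [hnu nuE] := expect_avg _ (fun i => (nu_E t i).1).
have [hIv IvE] := expect_avg _ (fun i => (Iv_E t i).1).
have [hIu IuE] := expect_avg _ (fun i => (Iu_E t i).1).
have n0 : (0 < n)%N := leq_trans m0 mn.
have nv_le : avg (fun i => expect P (nv t i)) <= sigv ^+ 2.
  by rewrite -(avg_cst m0 mn (sigv ^+ 2)); apply: (avg_le m0 mn) => i; case: (nv_E t i).
have nu_le : avg (fun i => expect P (nu t i)) <= sigu ^+ 2.
  by rewrite -(avg_cst m0 mn (sigu ^+ 2)); apply: (avg_le m0 mn) => i; case: (nu_E t i).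
have Iv0 : avg (fun i => expect P (Iv t i)) = 0.
  by rewrite /avg big1 ?mulr0// => i _; case: (Iv_E t i).
have Iu0 : avg (fun i => expect P (Iu t i)) = 0.
  by rewrite /avg big1 ?mulr0// => i _; case: (Iu_E t i).
rewrite -expectB//; apply: le_trans (round_le t) _.
have hq : L1 P (fun w => sqnorm (gradFu F (u t w) (fun i => v t i w)) / Lu).
  by apply: (L1_ext (f := fun w => Lu^-1 * sqnorm (gradFu F (u t w) (fun i => v t i w))))
    => [w|]; [rewrite mulrC|exact: L1Z].
have h1 : L1 P (fun w => sqnorm (gradFu F (u t w) (fun i => v t i w)) / Lu +
      p / Lv * avg (fun i => sqnorm (gv t i w))).
  by apply: L1D => //; exact: L1Z.
have h2 := L1Z (- (eta / 80)) h1.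
have h3 := L1D h2 (L1_cst P (cA eta p Lu delta ku)).
have h4 := L1D h3 (L1Z (cB eta p chi Lv kv) hnv).
have h5 := L1D h4 (L1Z (cC eta Lu ku) hnu).
have h6 := L1B h5 (L1Z p hIv).
have h7 := L1B h6 hIu.
apply: le_trans (expect_le _ h7 (round_pointwise t)) _.
  by apply: L1_sum => i; apply: L1D; exact: L1Z.
rewrite (expectB h6 hIu) (expectB h5 (L1Z p hIv)) (expectD h4 (L1Z _ hnu)).
rewrite (expectD h3 (L1Z _ hnv)) (expectD h2 (L1_cst P _)) (expectZ _ h1) expect_cst.
rewrite (expectZ _ hIv) (expectZ _ hnv) (expectZ _ hnu) IvE IuE nvE nuE Iv0 Iu0.
rewrite mulr0 !subr0 /budget -!addrA.
have -> : expect P (fun w => sqnorm (gradFu F (u t w) (fun i => v t i w)) / Lu +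
      p / Lv * avg (fun i => sqnorm (gv t i w))) = EU t / Lu + p / Lv * EV t.
  rewrite (expectD hq (L1Z _ (EV_L1 t))) (expectZ _ (EV_L1 t)); congr (_ + _).
  rewrite [RHS]mulrC -(expectZ _ (EU_L1 t)).
  by apply: expect_ext => w; rewrite mulrC.
by rewrite !lerD2l; apply: lerD; apply: ler_wpM2l.
Qed.

Context (Fstar : R).
Hypothesis hFstar : forall u (V : forall i : 'I_n, 'rV[R]_(d i)), Fstar <= Favg F u V.

Let telescoped T : eta / 80 * \sum_(t < T) (EU t / Lu + p / Lv * EV t) <=
  Favg F u0 V0 - Fstar + T%:R * budget.
Proof.
have hT : eta / 80 * \sum_(t < T) (EU t / Lu + p / Lv * EV t) <=
    expect P (Fs 0) - expect P (Fs T) + T%:R * budget.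
  have aux (e A B f0 f1 f2 N b : R) : f2 - f1 <= - e * A + b ->
      e * B <= f0 - f1 + N * b -> e * (B + A) <= f0 - f2 + (N + 1) * b.
    by move=> h1 h2; lra.
  elim: T => [|T IH]; first by rewrite big_ord0 mulr0 subrr mul0r addr0.
  rewrite big_ord_recr /= -[T.+1%:R]natr1.
  exact: aux (round_descent T) IH.
apply: le_trans hT _; rewrite lerD2r.
have -> : expect P (Fs 0) = Favg F u0 V0 by exact (expect_cst P (Favg F u0 V0)).
rewrite lerD2l lerN2 -(expect_cst P Fstar).
apply: (expect_le (L1_cst P Fstar) (Fs_L1 T)) => w; exact: hFstar.
Qed.

Lemma fedalt_bound (T : nat) : (0 < T)%N ->
  ((T%:R^-1)%:E * (\sum_(t < T)
     ((Lu^-1)%:E * \int[P]_w (sqnorm (gradFu F (st t w).1 (st t w).2))%:E +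
      (m%:R / (n%:R * Lv))%:E * \int[P]_w (n%:R^-1 * \sum_(i < n)
        sqnorm (gradv (F i) (st t w).1 ((st t w).2 i)))%:E)) <=
   (480 * ((Favg F u0 V0 - Fstar) / (eta * T%:R) +
     eta * (delta ^+ 2 / Lu * (1 - m%:R / n%:R) + sigu ^+ 2 / Lu
              + sigv ^+ 2 * (m%:R + chi ^+ 2 * (n%:R - m%:R)) / (Lv * n%:R)) +
     eta ^+ 2 * ((sigu ^+ 2 + delta ^+ 2) / Lu * (1 - tau_u%:R^-1)
              + sigv ^+ 2 * m%:R / (Lv * n%:R) * (1 - tau_v%:R^-1)
              + chi ^+ 2 * sigv ^+ 2 / Lv)))%:E)%E.
Proof.
move=> T0; have TR : 0 < T%:R :> R by rewrite ltr0n.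
have nR : 0 < n%:R :> R by rewrite ltr0n (leq_trans m0).
have -> : (\sum_(t < T)
     ((Lu^-1)%:E * \int[P]_w (sqnorm (gradFu F (st t w).1 (st t w).2))%:E +
      (m%:R / (n%:R * Lv))%:E * \int[P]_w (n%:R^-1 * \sum_(i < n)
        sqnorm (gradv (F i) (st t w).1 ((st t w).2 i)))%:E) =
   (\sum_(t < T) (EU t / Lu + p / Lv * EV t))%:E)%E.
  rewrite -sumEFin; apply: eq_bigr => t _.
  rewrite -(expectE (EU_L1 t)) -(expectE (EV_L1 t)) -!EFinM -EFinD; congr EFin.
  rewrite /p [EU t / Lu]mulrC; congr (_ + _ * _).
  by field; rewrite !gt_eqF.
rewrite -EFinM lee_fin.
have [kv0 kv1] := kappa_bounds _ htv; have [ku0 ku1] := kappa_bounds _ htu.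
have hb := noise_budget chi delta eta0 eta1 p0 p1 Lu0 Lv0 kv0 ku0 sigu sigv.
have ht := telescoped T.
have D0 : 0 <= Favg F u0 V0 - Fstar by rewrite subr_ge0.
rewrite -/budget in hb.
move: ht; set Sg := \sum_(t < T) _; set D1 := _ - Fstar; move=> ht.
set S1 := (X in eta ^+ 2 * X + _) in hb; set S2 := (X in eta ^+ 3 * X) in hb.
rewrite [X in _ <= 480 * X](_ : _ = D1 / (eta * T%:R) + eta * S1 + eta ^+ 2 * S2); last first.
  by rewrite /S1 /S2 /p /ku /kv; field; rewrite !gt_eqF// ltr0n.
(* The telescoped sum multiplied by 80 / eta, with the noise budget inserted; the products 80 * 6
   give 480. *)
have h : Sg <= 80 / eta * (D1 + T%:R * (6 * (eta ^+ 2 * S1 + eta ^+ 3 * S2))).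
  have e80 : 0 < eta / 80 by rewrite divr_gt0.
  rewrite -(ler_pM2l e80); apply: le_trans ht _.
  rewrite [leRHS]mulrA (_ : eta / 80 * (80 / eta) = 1); last by field; rewrite gt_eqF.
  by rewrite mul1r lerD2l ler_pM2l.
have iT0 : 0 <= T%:R^-1 :> R by rewrite invr_ge0 ltW.
apply: le_trans (ler_wpM2l iT0 h) _.
have -> : T%:R^-1 * (80 / eta * (D1 + T%:R * (6 * (eta ^+ 2 * S1 + eta ^+ 3 * S2)))) =
    80 * (D1 / (eta * T%:R)) + 480 * (eta * S1 + eta ^+ 2 * S2).
  by field; rewrite !gt_eqF.
(* The initial gap comes with 80 only; it is nonnegative, so 80 may be raised to 480. *)
have X0 : 0 <= D1 / (eta * T%:R) by rewrite divr_ge0 ?mulr_ge0// ltW.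
rewrite -[_ + eta * S1 + _]addrA [leRHS]mulrDr lerD2r.
by rewrite ler_wpM2r// ler_nat.
Qed.

End FedAlt.

Theorem theorem3 :
  forall R : realType, exists C : R, 0 < C /\
  forall
    (* (S) devices, rounds, dimensions *)
    (n m T : nat) (hn : (2 <= n)%N) (hm1 : (1 <= m)%N) (hmn : (m <= n)%N)
    (hT : (1 <= T)%N)
    (d0 : nat) (d : 'I_n -> nat)
    (* losses, continuously differentiable, F bounded below by Fstar *)
    (F : forall i : 'I_n, 'rV[R]_d0 -> 'rV[R]_(d i) -> R)
    (hFdiff : forall (i : 'I_n) (p : 'rV[R]_d0 * 'rV[R]_(d i)),
        differentiable (fun q : 'rV[R]_d0 * 'rV[R]_(d i) => F i q.1 q.2) p)
    (hFC1u : forall i : 'I_n,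
        continuous (fun q : 'rV[R]_d0 * 'rV[R]_(d i) => gradu (F i) q.1 q.2))
    (hFC1v : forall i : 'I_n,
        continuous (fun q : 'rV[R]_d0 * 'rV[R]_(d i) => gradv (F i) q.1 q.2))
    (Fstar : R)
    (hFstar : forall u (V : forall i : 'I_n, 'rV[R]_(d i)), Fstar <= Favg F u V)
    (* data distributions and stochastic gradient maps *)
    (dZ : measure_display) (Z : measurableType dZ) (D : 'I_n -> probability Z R)
    (Gu : forall i : 'I_n, 'rV[R]_d0 -> 'rV[R]_(d i) -> Z -> 'rV[R]_d0)
    (Gv : forall i : 'I_n, 'rV[R]_d0 -> 'rV[R]_(d i) -> Z -> 'rV[R]_(d i))
    (hGu_meas : forall (i : 'I_n) (j : 'I_d0),
        jointly_measurable (fun p : 'rV[R]_d0 * 'rV[R]_(d i) * Z =>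
                              Gu i p.1.1 p.1.2 p.2 0 j))
    (hGv_meas : forall (i : 'I_n) (j : 'I_(d i)),
        jointly_measurable (fun p : 'rV[R]_d0 * 'rV[R]_(d i) * Z =>
                              Gv i p.1.1 p.1.2 p.2 0 j))
    (* (A1) smoothness *)
    (Lu Lv Luv Lvu chi : R) (hLu : 0 < Lu) (hLv : 0 < Lv) (hchi : 0 < chi)
    (hA1uu : forall (i : 'I_n) (v : 'rV[R]_(d i)) (u u' : 'rV[R]_d0),
        enorm (gradu (F i) u v - gradu (F i) u' v) <= Lu * enorm (u - u'))
    (hA1vv : forall (i : 'I_n) (u : 'rV[R]_d0) (v v' : 'rV[R]_(d i)),
        enorm (gradv (F i) u v - gradv (F i) u v') <= Lv * enorm (v - v'))
    (hA1uv : forall (i : 'I_n) (u : 'rV[R]_d0) (v v' : 'rV[R]_(d i)),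
        enorm (gradu (F i) u v - gradu (F i) u v') <= Luv * enorm (v - v'))
    (hA1vu : forall (i : 'I_n) (v : 'rV[R]_(d i)) (u u' : 'rV[R]_d0),
        enorm (gradv (F i) u v - gradv (F i) u' v) <= Lvu * enorm (u - u'))
    (hchiL : Num.max Luv Lvu <= chi * Num.sqrt (Lu * Lv))
    (* (A2) unbiasedness and bounded variance *)
    (sigu sigv : R) (hsigu : 0 <= sigu) (hsigv : 0 <= sigv)
    (hA2u_mean : forall (i : 'I_n) u v (j : 'I_d0),
        (D i).-integrable setT (fun z => (Gu i u v z 0 j)%:E) /\
        (\int[D i]_z (Gu i u v z 0 j)%:E = (gradu (F i) u v 0 j)%:E)%E)
    (hA2v_mean : forall (i : 'I_n) u v (j : 'I_(d i)),
        (D i).-integrable setT (fun z => (Gv i u v z 0 j)%:E) /\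
        (\int[D i]_z (Gv i u v z 0 j)%:E = (gradv (F i) u v 0 j)%:E)%E)
    (hA2u_var : forall (i : 'I_n) u v,
        (\int[D i]_z (sqnorm (Gu i u v z - gradu (F i) u v))%:E
           <= (sigu ^+ 2)%:E)%E)
    (hA2v_var : forall (i : 'I_n) u v,
        (\int[D i]_z (sqnorm (Gv i u v z - gradv (F i) u v))%:E
           <= (sigv ^+ 2)%:E)%E)
    (* (A3) partial gradient diversity *)
    (delta rho : R) (hdelta : 0 <= delta) (hrho : 0 <= rho)
    (hA3 : forall u (V : forall i : 'I_n, 'rV[R]_(d i)),
        n%:R^-1 * \sum_(i < n) sqnorm (gradu (F i) u (V i) - gradFu F u V)
          <= delta ^+ 2 + rho ^+ 2 * sqnorm (gradFu F u V))
    (* FedAlt parameters *)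
    (tau_u tau_v : nat) (htu : (1 <= tau_u)%N) (htv : (1 <= tau_v)%N)
    (eta : R) (heta0 : 0 < eta)
    (heta1 : eta <= (24 * (1 + rho ^+ 2))^-1)
    (heta2 : 128 * chi ^+ 2 * (n%:R - m%:R) * eta <= m%:R)
    (heta3 : eta <= Num.sqrt (m%:R / (chi ^+ 2 * n%:R)))
    (u0 : 'rV[R]_d0) (V0 : forall i : 'I_n, 'rV[R]_(d i))
    (* the randomness: a probability space carrying the sampled sets and
       the fresh samples, all mutually independent *)
    (dO : measure_display) (Omega : measurableType dO) (P : probability Omega R)
    (S : nat -> Omega -> {set 'I_n})
    (zv zu : nat -> 'I_n -> nat -> Omega -> Z)
    (hS_meas : forall t (A : {set 'I_n}), measurable [set w | S t w = A])
    (hS_unif : forall t (A : {set 'I_n}),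
        P [set w | S t w = A] = (if #|A| == m then ('C(n, m)%:R)^-1 else 0)%:E)
    (hzv_meas : forall t i k, measurable_fun setT (zv t i k))
    (hzu_meas : forall t i k, measurable_fun setT (zu t i k))
    (hzv_law : forall t i k (B : set Z), measurable B ->
        P (zv t i k @^-1` B) = D i B)
    (hzu_law : forall t i k (B : set Z), measurable B ->
        P (zu t i k @^-1` B) = D i B)
    (hindep : mutually_independent P (fedalt_events S zv zu)),
  let gam_u := eta / (Lu * tau_u%:R) in
  let gam_v := eta / (Lv * tau_v%:R) in
  let st := fun (t : nat) (w : Omega) =>
    fedalt_state m Gu Gv gam_u gam_v tau_u tau_v
      (fun t' => S t' w) (fun t' i k => zv t' i k w) (fun t' i k => zu t' i k w)
      u0 V0 t in
  let EDu := fun t : nat =>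
    (\int[P]_w (sqnorm (gradFu F (st t w).1 (st t w).2))%:E)%E in
  let EDv := fun t : nat =>
    (\int[P]_w (n%:R^-1 * \sum_(i < n)
                 sqnorm (gradv (F i) (st t w).1 ((st t w).2 i)))%:E)%E in
  let DF0 := Favg F u0 V0 - Fstar in
  let sig1 := delta ^+ 2 / Lu * (1 - m%:R / n%:R) + sigu ^+ 2 / Lu
              + sigv ^+ 2 * (m%:R + chi ^+ 2 * (n%:R - m%:R)) / (Lv * n%:R) in
  let sig2 := (sigu ^+ 2 + delta ^+ 2) / Lu * (1 - tau_u%:R^-1)
              + sigv ^+ 2 * m%:R / (Lv * n%:R) * (1 - tau_v%:R^-1)
              + chi ^+ 2 * sigv ^+ 2 / Lv in
  ((T%:R^-1)%:E *
     (\sum_(t < T) ((Lu^-1)%:E * EDu t + (m%:R / (n%:R * Lv))%:E * EDv t))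
   <= (C * (DF0 / (eta * T%:R) + eta * sig1 + eta ^+ 2 * sig2))%:E)%E.
Proof.
move=> R; exists 480; split; first by rewrite ltr0n.
move=> n m T hn hm1 hmn hT d0 d F hFdiff hFC1u hFC1v Fstar hFstar dZ Z D Gu Gv.
move=> hGu_meas hGv_meas Lu Lv Luv Lvu chi hLu hLv hchi hA1uu hA1vv hA1uv hA1vu hchiL.
move=> sigu sigv hsigu hsigv hA2u_mean hA2v_mean hA2u_var hA2v_var.
move=> delta rho hdelta hrho hA3 tau_u tau_v htu htv eta heta0 heta1 heta2 heta3.
move=> u0 V0 dO Omega P S zv zu hS_meas hS_unif hzv_meas hzu_meas hzv_law hzu_law hindep.
have nR : 0 < n%:R :> R by rewrite ltr0n (leq_trans hm1).
have chi2 : 0 < chi ^+ 2 by rewrite exprn_gt0.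
have eta1 : eta * (24 * (1 + rho ^+ 2)) <= 1.
  have r0 : 0 < 24 * (1 + rho ^+ 2) by rewrite mulr_gt0// ltr_pwDl// sqr_ge0.
  by rewrite -ler_pdivlMr// div1r.
(* The condition is given without the denominator n - m, which would be zero for m = n; dividing by
   n expresses it through m/n. *)
have eta2 : 128 * chi ^+ 2 * (1 - m%:R / n%:R) * eta <= m%:R / n%:R.
  rewrite ler_pdivlMr// (_ : _ * n%:R = 128 * chi ^+ 2 * (n%:R - m%:R) * eta)//.
  by field; rewrite gt_eqF.
have eta3 : chi ^+ 2 * eta ^+ 2 <= m%:R / n%:R.
  have q0 : 0 <= m%:R / (chi ^+ 2 * n%:R) by rewrite divr_ge0// mulr_ge0// ltW.
  have h : eta ^+ 2 <= m%:R / (chi ^+ 2 * n%:R).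
    by rewrite -(sqr_sqrtr q0) lerXn2r// nnegrE ?sqrtr_ge0// ltW.
  have -> : m%:R / n%:R = chi ^+ 2 * (m%:R / (chi ^+ 2 * n%:R)) :> R.
    by field; rewrite !gt_eqF.
  by rewrite ler_pM2l.
by apply: (fedalt_bound n m hm1 hmn F hFdiff hFC1u hFC1v dZ Z D Gu Gv hGu_meas hGv_meas
  Lu Lv Luv Lvu chi).
Qed.
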